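(* Let $n\ge 2$. Any connected rotationally invariant time-like translator in $\mathbb{H}^n\times_{-1}\mathbb{R}$ is an open subset of a spindle.
   Context: $\mathbb{H}^n=\{p\in\mathbb{L}^{n+1}:\langle p,p\rangle_L=-1,\ p_{n+1}>0\}$, where $\mathbb{L}^{n+1}=\mathbb{R}^{n+1}$ with $\langle x,y\rangle_L=x_1y_1+\dots+x_ny_n-x_{n+1}y_{n+1}$; $g_{\mathbb{H}^n}$ is the induced metric. $\mathbb{H}^n\times_{-1}\mathbb{R}$ is $\mathbb{H}^n\times\mathbb{R}$ with the Lorentzian metric $g_{\mathbb{H}^n}-dt^2$. A translator is a non-degenerate hypersurface whose mean curvature vector (trace of the second fundamental form) equals $\partial_t^\perp$, the projection of $\partial_t$ onto the normal bundle; it is time-like if the induced metric is Lorentzian. It is rotationally invariant if it is invariant under $SO(n)$ acting on the first $n$ coordinates of $\mathbb{L}^{n+1}$ (and trivially on the $\mathbb{R}$ factor). Put $\tau(p)=\operatorname{arccosh}(p_{n+1})$, the hyperbolic distance to $(0,\dots,0,1)$. Spindle: let $t_0\in\mathbb{R}$, $g_0>0$, and let $g:J\to(0,+\infty)$ be the maximal solution of $$g''(t)=\left(g'(t)^2-1\right)\left((n-1)\coth(g(t))-g'(t)\right),\qquad g(t_0)=g_0,\quad g'(t_0)=0.$$ (This is the equation satisfied by inverse functions $g$ of solutions $f$ of $f''=(1-f'^2)(1-(n-1)\coth(s)f')$.) The associated spindle is the hypersurface $\{(p,t)\in\mathbb{H}^n\times\mathbb{R}: t\in J,\ \tau(p)=g(t)\}$.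 Near $\tau=g_0$ it is the union of two graphs $t=f_\pm(\tau)$, where $f_\pm$ are the local inverses of $g$ on either side of $t_0$, glued along their common boundary $\{\tau=g_0,\ t=t_0\}$. *)

(* Defs.v *)
From HB Require Import structures.
From mathcomp Require Import all_boot all_order all_algebra.
From mathcomp Require Import all_classical all_reals all_analysis.
Import Order.TTheory GRing.Theory Num.Theory.
Import numFieldNormedType.Exports.

Set Implicit Arguments.
Unset Strict Implicit.
Unset Printing Implicit Defensive.

Local Open Scope classical_set_scope.
Local Open Scope ring_scope.

(* The vector space L^{n+1} x R.  Points of H^n x R, and tangent vectors to
   H^n x R, are both elements of this space. *)
Notation ambient R n := ('rV[R]_(n + 1) * R)%type.

Section HyperbolicProduct.
Variables (R : realType) (n : nat).
Implicit Types (p x y : 'rV[R]_(n + 1)) (q a b w : ambient R n).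

Definition height p : R := rsubmx p 0 0.

Definition lorentz x y : R :=
  \sum_(i < n) lsubmx x 0 i * lsubmx y 0 i - height x * height y.

Definition hyperbolic : set 'rV[R]_(n + 1) :=
  [set p | lorentz p p = -1 /\ 0 < height p].

Definition hyperbolicXR : set (ambient R n) := [set q | hyperbolic q.1].

(* On T(H^n x R) this is the metric g_{H^n} - dt^2. *)
Definition metric a b : R := lorentz a.1 b.1 - a.2 * b.2.

(* Orthogonal projection of the ambient space onto T_q(H^n x R): the normal
   line is spanned by (q.1, 0), and lorentz q.1 q.1 = -1. *)
Definition tangent_part q w : ambient R n :=
  (w.1 + lorentz q.1 w.1 *: q.1, w.2).

Definition dt : ambient R n := (0, 1).

Definition arcosh (y : R) : R := ln (y + Num.sqrt (y ^+ 2 - 1)).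

Definition tau p : R := arcosh (height p).

Definition rotation_matrix (B : 'M[R]_n) : Prop := B *m B^T = 1%:M /\ \det B = 1.

Definition rotate (B : 'M[R]_n) q : ambient R n :=
  (row_mx (lsubmx q.1 *m B) (rsubmx q.1), q.2).

End HyperbolicProduct.

Section Smoothness.
Variables (R : realType) (U W : normedModType R).

Fixpoint Ck (k : nat) (V : set U) (f : U -> W) : Prop :=
  match k with
  | 0%N => forall v, V v -> {for v, continuous f}
  | k'.+1 => (forall v, V v -> differentiable f v) /\
             (forall u, Ck k' V (fun v => 'D_u f v))
  end.

Definition smooth_on (V : set U) (f : U -> W) : Prop := forall k, Ck k V f.

End Smoothness.

Section Hypersurfaces.
Variables (R : realType) (n : nat).
Implicit Types (S : set (ambient R n)) (V : set 'rV[R]_n).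
Implicit Types (X : 'rV[R]_n -> ambient R n) (v : 'rV[R]_n).

(* A smooth immersion of V that is a homeomorphism onto an open subset of S,
   for the topology of S as a subspace. *)
Definition local_parametrization S V X : Prop :=
  [/\ open V,
      smooth_on V X,
      forall v, V v -> forall u, 'D_u X v = 0 -> u = 0,
      forall v v', V v -> V v' -> X v = X v' -> v = v' &
      forall V', open V' -> V' `<=` V ->
        exists2 U, open U & X @` V' = S `&` U].

Definition hypersurface S : Prop :=
  S `<=` @hyperbolicXR R n /\
  forall q, S q -> exists V X, local_parametrization S V X /\ (X @` V) q.

Definition partial X (i : 'I_n) v : ambient R n := 'D_(delta_mx 0 i) X v.

Definition gram X v : 'M[R]_n :=
  \matrix_(i, j) metric (partial X i v) (partial X j v).

Definition normal_part X v (w : ambient R n) : ambient R n :=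
  w - \sum_(i < n) \sum_(j < n)
        (invmx (gram X v) i j * metric w (partial X i v)) *: partial X j v.

(* The Levi-Civita derivative in H^n x R is the tangential part of the
   derivative in the flat space L^{n+1} x R. *)
Definition levi_civita X (i j : 'I_n) v : ambient R n :=
  tangent_part (X v) (partial (partial X j) i v).

Definition second_fundamental_form X (i j : 'I_n) v : ambient R n :=
  normal_part X v (levi_civita X i j v).

Definition mean_curvature X v : ambient R n :=
  \sum_(i < n) \sum_(j < n)
    invmx (gram X v) i j *: second_fundamental_form X i j v.

Definition nondegenerate S : Prop :=
  forall V X, local_parametrization S V X ->
  forall v, V v -> gram X v \in unitmx.

Definition translator S : Prop :=
  [/\ hypersurface S, nondegenerate S &
      forall V X, local_parametrization S V X ->
      forall v, V v -> mean_curvature X v = normal_part X v (@dt R n)].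

Definition minkowski_mx : 'M[R]_n :=
  diag_mx (\row_(i < n) (if i.+1 == n then -1 else 1)).

(* Some frame of the tangent space is orthonormal of signature (n - 1, 1). *)
Definition lorentzian_gram (G : 'M[R]_n) : Prop :=
  exists2 P : 'M[R]_n, P \in unitmx & P *m G *m P^T = minkowski_mx.

Definition timelike S : Prop :=
  forall V X, local_parametrization S V X ->
  forall v, V v -> lorentzian_gram (gram X v).

Definition rotationally_invariant S : Prop :=
  forall B, rotation_matrix B -> forall q, S q -> S (rotate B q).

End Hypersurfaces.

Section Spindles.
Variables (R : realType) (n : nat).

Definition coth (x : R) : R := (expR x + expR (- x)) / (expR x - expR (- x)).

Definition spindle_solution (t0 g0 : R) (J : set R) (g : R -> R) : Prop :=
  [/\ open J, is_interval J, J t0, g t0 = g0 /\ derive1 g t0 = 0 &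
      forall t, J t ->
        [/\ 0 < g t, derivable g t 1, derivable (derive1 g) t 1 &
            derive1 (derive1 g) t =
              (derive1 g t ^+ 2 - 1) * ((n%:R - 1) * coth (g t) - derive1 g t)]].

Definition maximal_spindle_solution (t0 g0 : R) (J : set R) (g : R -> R) : Prop :=
  spindle_solution t0 g0 J g /\
  forall K h, spindle_solution t0 g0 K h ->
    J `<=` K -> (forall t, J t -> h t = g t) -> K = J.

Definition spindle (S : set (ambient R n)) : Prop :=
  exists t0 g0 J g,
    [/\ 0 < g0, maximal_spindle_solution t0 g0 J g &
        S = [set q | [/\ hyperbolicXR q, J q.2 & tau q.1 = g q.2]]].

End Spindles.

Definition open_subset_of (T : topologicalType) (A S : set T) : Prop :=
  exists2 U, open U & A = S `&` U.

(* Main.v *)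
(** The height h and the time t of a point are invariant under the rotations, so
    on a parameter domain the differential of (h, t) kills the orbit directions
    and has rank at most one.  Time-likeness makes dt nonzero and excludes the
    axis, where the tangent hyperplane would be rotation invariant, hence
    space-like.  So dh = lam dt with lam^2 < h^2 - 1.  Differentiating this
    relation and pairing the mean curvature equation with a normal vector gives
    d lam = mu(h, lam) dt for an explicit mu, and with x = arcosh h and
    y = lam / sqrt (h^2 - 1) the pair satisfies dx = y dt, dy = F(x, y) dt, where
    x' = y, y' = F(x, y) is the spindle equation.  By uniqueness for this system
    along segments of the parameter domain, the hypersurface is locally the graph
    x = psi(t) of a solution with |psi'| < 1.  Such a solution is concave and, run
    towards its maximum, reaches a zero of psi' within finite time, so it is
    part of a spindle.  Connectedness shows that a single maximal solution serves
    all points: the set of points near which the hypersurface lies on its graph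
    is open, and closed because a local solution meeting the maximal one is
    absorbed by it.  Finally t is open on the hypersurface, and SO(n) acts
    transitively on the level sets of (x, t), so the hypersurface is open in the
    spindle. *)

From HB Require Import structures.
Require Import Defs.
From mathcomp Require Import all_boot all_order all_algebra.
From mathcomp Require Import all_classical all_reals all_analysis.
From mathcomp Require Import ring lra.
Import Order.TTheory GRing.Theory Num.Theory.
Import numFieldNormedType.Exports.

Set Implicit Arguments.
Unset Strict Implicit.
Unset Printing Implicit Defensive.

Local Open Scope classical_set_scope.
Local Open Scope ring_scope.

(** * Calculus on the real line *)

(** Parametrizations are arbitrary and have merely continuous inverses, so no coordinates adapted to
    the orbits are introduced: the geometry is stated through differentials, and the spindle system
    is read along segments as a flow whose speed k = dt(d) may vanish or change sign. The function
    mu arises as follows. Put rho = lam^2 / (h^2 - 1) - 1, which is negative. Paired with the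
    normal, the second fundamental form is - h g + (mu - h) dt dt, and the inverse metric gives dt
    the square 1 / rho, so its trace is - n h + (mu - h) / rho; the right-hand side of the
    translator equation gives - lam. Hence mu = h + rho (n h - lam). In terms of x and y, rho = y^2
    - 1; the denominator of y contributes - y^2 coth x to y', which together with the summand coth x
    lowers n to n - 1. A spindle must contain a point with g' = 0, while the given piece may lie far
    from it; local existence is therefore not enough, and a truncated equation is solved on the
    whole line. *)

Section RealLine.
Variable R : realType.
Implicit Types (f g : R -> R) (a b t : R).

Lemma is_derive_continuous f t l : is_derive t 1 f l -> {for t, continuous f}.
Proof. by move=> [+ _] => /derivable1_diffP/differentiable_continuous. Qed.

Lemma is_derive_within_continuous f (df : R -> R) a b :
  (forall t, a <= t <= b -> is_derive t 1 f (df t)) ->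
  {within `[a, b], continuous f}.
Proof.
move=> fd; apply: continuous_in_subspaceT => t.
by rewrite inE /= in_itv /= => /fd/is_derive_continuous.
Qed.

Lemma mean_value f (df : R -> R) a b : a <= b ->
  (forall t, a <= t <= b -> is_derive t 1 f (df t)) ->
  exists2 c, a <= c <= b & f b - f a = df c * (b - a).
Proof.
move=> ab fd; have [||c] := @MVT_segment R f df a b ab; last first.
- by rewrite in_itv /= => abc e; exists c.
- exact: is_derive_within_continuous fd.
- by move=> t; rewrite in_itv /= => /andP[at_ tb]; apply: fd; rewrite !ltW.
Qed.

Lemma derive_ge0_le f (df : R -> R) a b : a <= b ->
  (forall t, a <= t <= b -> is_derive t 1 f (df t)) ->
  (forall t, a <= t <= b -> 0 <= df t) -> f a <= f b.
Proof.
move=> ab fd df0; have [c /df0 c0 e] := mean_value ab fd.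
by rewrite -subr_ge0 e mulr_ge0 // subr_ge0.
Qed.

Lemma derive_le f g (df dg : R -> R) a b : a <= b ->
  (forall t, a <= t <= b -> is_derive t 1 f (df t)) ->
  (forall t, a <= t <= b -> is_derive t 1 g (dg t)) ->
  (forall t, a <= t <= b -> df t <= dg t) -> f b - f a <= g b - g a.
Proof.
move=> ab fd gd dfg.
suff : g a - f a <= g b - f b by lra.
apply: (@derive_ge0_le (fun t => g t - f t) (fun t => dg t - df t)) => // t abt.
  by have := fd _ abt; have := gd _ abt => ? ?; exact: is_deriveB.
by rewrite subr_ge0 dfg.
Qed.

Lemma is_derive_flip f l t : is_derive (- t) 1 f l ->
  is_derive t 1 (fun s => f (- s)) (- l).
Proof.
move=> fd; have -> : - l = l * - 1 by rewrite mulrN1.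
exact: (@is_derive1_comp _ f -%R).
Qed.

Lemma is_derive_shift_arg f l t c : is_derive (t + c) 1 f l ->
  is_derive t 1 (fun s => f (s + c)) l.
Proof.
move=> fd; have -> : l = l * (1 + 0) by rewrite addr0 mulr1.
by apply: (@is_derive1_comp _ f (fun s => s + c)).
Qed.

Lemma is_derive_near_eq (f g : R -> R) t l e : 0 < e ->
  (forall s, `|s - t| < e -> f s = g s) -> is_derive t 1 f l -> is_derive t 1 g l.
Proof.
move=> e0 fg; apply: near_eq_is_derive; apply/nbhs_ballP; exists e => //= s.
by rewrite /ball /= distrC => /fg.
Qed.

Lemma antiderivative_right f a : continuous f ->
  exists P : R -> R, forall t, a < t -> is_derive t 1 P (f t).
Proof.
move=> fc; exists (fun x => \int[lebesgue_measure]_(t in `[a, x]) f t)%R => t at_.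
have [] := @continuous_FTC1_closed R f a t (t + 1) _ _ at_ (fc t).
- by rewrite ltrDl.
- apply: continuous_compact_integrable; first exact: segment_compact.
  exact: continuous_subspaceT.
by move=> d; rewrite derive1E => <-; apply: DeriveDef.
Qed.

(** Integration from a base point yields a primitive only to its right. A reflected copy covers the
    left, and on the overlap [(-1, 1)] the two differ by the constant [c], so they can be joined at
    0. *)
Lemma antiderivative f : continuous f ->
  exists P : R -> R, forall t, is_derive t 1 P (f t).
Proof.
move=> fc; have [P Pd] := antiderivative_right (-1) fc.
have [|Q Qd] := @antiderivative_right (fun t => f (- t)) (-1).
  move=> t; apply: (@continuous_comp _ _ _ (@GRing.opp R) f); last exact: fc.
  exact: opp_continuous.
pose B t := - Q (- t).
have Bd t : t < 1 -> is_derive t 1 B (f t).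
  move=> t1; have /Qd : -1 < - t by rewrite ltrN2.
  rewrite opprK => /is_derive_flip H.
  by rewrite /B -[f t]opprK; apply: is_deriveN.
pose c := P 0 - B 0.
have PB t : -1 < t -> t < 1 -> P t = B t + c.
  move=> h1 h2; have [t0|t0] := leP 0 t.
    have Pt s : 0 <= s <= t -> is_derive s 1 P (f s) by move=> ?; apply: Pd; lra.
    have Bt s : 0 <= s <= t -> is_derive s 1 B (f s) by move=> ?; apply: Bd; lra.
    have H1 : P t - P 0 <= B t - B 0 by apply: (derive_le _ Pt Bt) => //; lra.
    have H2 : B t - B 0 <= P t - P 0 by apply: (derive_le _ Bt Pt) => //; lra.
    by rewrite /c; lra.
  have Pt s : t <= s <= 0 -> is_derive s 1 P (f s) by move=> ?; apply: Pd; lra.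
  have Bt s : t <= s <= 0 -> is_derive s 1 B (f s) by move=> ?; apply: Bd; lra.
  have H1 : P 0 - P t <= B 0 - B t by apply: (derive_le _ Pt Bt) => //; lra.
  have H2 : B 0 - B t <= P 0 - P t by apply: (derive_le _ Bt Pt) => //; lra.
  by rewrite /c; lra.
exists (fun t => if 0 < t then P t else B t + c) => t.
have [t0|t0] := ltP 0 t.
  have Pt : is_derive t 1 P (f t) by apply: Pd; lra.
  by apply: (is_derive_near_eq t0 _ Pt) => s; rewrite ltr_norml => s0; rewrite ifT //; lra.
have Bt : is_derive t 1 (fun t => B t + c) (f t).
  have H : is_derive t 1 B (f t) by apply: Bd; lra.
  by rewrite -[f t]addr0; apply: is_deriveD.
apply: (is_derive_near_eq (ltr01) _ Bt) => // s; rewrite ltr_norml => s0.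
by case: ltP => // s1; rewrite PB //; lra.
Qed.

End RealLine.

(** * Limits of sequences of differentiable functions *)

Section GlobalSolution.
Variable R : realType.
Implicit Types (t : R).

Lemma near_geometric_cvg (u : R^nat) (C : R) :
  (forall k, `|u k.+1 - u k| <= C / 2 ^+ k) ->
  exists l, forall k, `|l - u k| <= 2 * C / 2 ^+ k.
Proof.
move=> uC.
have two k : 0 < 2 ^+ k :> R by exact: exprn_gt0.
have C0 : 0 <= C.
  by have := uC 0%N; rewrite expr0 divr1; apply: le_trans.
(* The bound is the exact value of the geometric sum, so that the induction on [m] closes. *)
have um k m : `|u (k + m)%N - u k| <= 2 * C / 2 ^+ k - 2 * C / 2 ^+ (k + m).
  elim: m => [|m IH]; first by rewrite addn0 !subrr normr0.
  rewrite addnS -(subrK (u (k + m)%N) (u (k + m).+1)) -addrA.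
  apply: le_trans (ler_normD _ _) _; apply: le_trans (lerD (uC _) IH) _.
  rewrite exprS invfM.
  by have := two (k + m)%N; set z := (2 ^+ (k + m))^-1; lra.
have umle k m : `|u (k + m)%N - u k| <= 2 * C / 2 ^+ k.
  apply: le_trans (um k m) _.
  by rewrite gerBl divr_ge0 ?mulr_ge0 // ltW.
have small : (fun k => 2 * C / 2 ^+ k : R) @ \oo --> (0 : R).
  have -> : (fun k => 2 * C / 2 ^+ k : R) = (fun k => 2 * C * 2^-1 ^+ k).
    by apply/funext => k; rewrite exprVn.
  rewrite -[X in _ --> X](mulr0 (2 * C)); apply: cvgMr; apply: cvg_expr.
  by rewrite ger0_norm ?invr_ge0 // invf_lt1 // ltr1n.
have uc : cvgn u.
  apply: cauchy_cvg; apply: cauchy_exP => e e0.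
  move/cvgrPdist_lt : small => /(_ _ e0)[N _ HN].
  exists (u N); exists N => //= k /= /subnKC <-.
  rewrite /ball /= distrC; apply: le_lt_trans (umle _ _) _.
  by have := HN N (leqnn N); rewrite sub0r normrN; apply: le_lt_trans; exact: ler_norm.
exists (limn u) => k; rewrite distrC.
have -> : u k - limn u = limn (fun m => u k - u m).
  by apply/esym/cvg_lim => //; apply: cvgB; [exact: cvg_cst|].
have cm : cvgn (fun m => u k - u m) by apply: is_cvgB; [exact: is_cvg_cst|].
rewrite -lim_norm //; apply: limr_le; first exact: is_cvg_norm.
exists k => //= m /= /subnKC <-; rewrite distrC; exact: umle.
Qed.

Lemma is_deriveP (f : R -> R) t (l : R) :
  is_derive t 1 f l <->
  forall e, 0 < e -> exists2 d, 0 < d & forall s, `|s - t| < d ->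
    `|f s - f t - l * (s - t)| <= e * `|s - t|.
Proof.
have quot s : s != 0 -> s^-1 *: (f (s *: (1 : R) + t) - f t) - l =
    s^-1 * (f (s + t) - f t - l * s).
  by move=> s0; rewrite /GRing.scale /= mulr1 [RHS]mulrBr [in RHS]mulrCA mulVf // mulr1.
split=> [[fd <-] e e0|H].
  move: fd; rewrite /derivable => /cvg_ex[/= l' fl].
  have E : 'D_1 f t = l' by apply/cvg_lim.
  rewrite E; move/cvgrPdist_le : fl => /(_ _ e0)[/= d d0 Hd].
  exists d => // s sd; have [->|st] := eqVneq s t; first by rewrite !subrr mulr0 subr0 normr0 mulr0.
  have st0 : s - t != 0 by rewrite subr_eq0.
  have := Hd (s - t); rewrite /ball /= sub0r normrN => /(_ sd st0).
  rewrite distrC /GRing.scale /= mulr1 subrK => Hq.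
  have -> : f s - f t - l' * (s - t) = ((s - t)^-1 * (f s - f t) - l') * (s - t).
    by rewrite mulrBl mulrAC mulVf // mul1r.
  by rewrite normrM ler_wpM2r.
have fl : h^-1 *: (f (h *: (1 : R) + t) - f t) @[h --> 0^'] --> l.
  apply/cvgrPdist_le => e e0; have [d d0 Hd] := H e e0.
  exists d => //= s; rewrite /ball /= sub0r normrN => sd s0.
  rewrite distrC quot // normrM normfV mulrC ler_pdivrMr ?normr_gt0 //.
  by have := Hd (s + t); rewrite addrK; apply.
by apply: DeriveDef; [apply/cvg_ex; exists l|apply/cvg_lim].
Qed.

Lemma mean_value_norm (f df : R -> R) (l e a b : R) :
  (forall t, `|t - a| <= `|b - a| -> is_derive t 1 f (df t)) ->
  (forall t, `|t - a| <= `|b - a| -> `|df t - l| <= e) ->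
  `|f b - f a - l * (b - a)| <= e * `|b - a|.
Proof.
move=> fd dfl; have [ab|ba] := leP a b.
  have [|c cab ->] := @mean_value _ f df a b ab.
    by move=> s sab; apply: fd; rewrite !ger0_norm; lra.
  rewrite -mulrBl normrM ler_wpM2r // dfl // !ger0_norm; lra.
have [|c cab E] := @mean_value _ f df b a (ltW ba).
  by move=> s sab; apply: fd; rewrite !ler0_norm; lra.
have -> : f b - f a - l * (b - a) = (df c - l) * (b - a) by lra.
rewrite normrM ler_wpM2r // dfl // !ler0_norm; lra.
Qed.

(** The mean value inequality bounds the first-order remainder of [u k] at [t] uniformly in large
    [k]; this passes to the limit with [s] and [t] fixed, so pointwise convergence of [u] suffices
    and only [v] has to converge uniformly near [t]. *)
Lemma is_derive_lim (u v : nat -> R -> R) (y Y : R -> R) t :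
  (forall k (s : R), is_derive s 1 (u k) (v k s)) ->
  (forall s e, 0 < e -> exists N, forall k, (N <= k)%N -> `|u k s - y s| <= e) ->
  (forall e, 0 < e -> exists N, exists2 d, 0 < d & forall k s, (N <= k)%N ->
     `|s - t| < d -> `|v k s - Y s| <= e) ->
  {for t, continuous Y} -> is_derive t 1 y (Y t).
Proof.
move=> uv uy vY Yc; apply/is_deriveP => e e0.
have e2 : 0 < e / 2 by rewrite divr_gt0.
have [N [d d0 Hd]] := vY _ e2.
move/cvgrPdist_le : Yc => /(_ _ e2)[/= d' d'0 Hd'].
exists (Num.min d d'); first by rewrite lt_min d0.
move=> s; rewrite lt_min => /andP[sd sd'].
apply/ler_addgt0Pr => r r0.
have r2 : 0 < r / 2 by rewrite divr_gt0.
have [N1 H1] := uy s _ r2; have [N2 H2] := uy t _ r2.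
pose k := maxn N (maxn N1 N2).
have Nk : (N <= k)%N by rewrite leq_maxl.
have {}H1 := H1 k; have {}H2 := H2 k.
have {H1} H1 : `|u k s - y s| <= r / 2 by apply: H1; rewrite /k !leq_max leqnn !orbT.
have {H2} H2 : `|u k t - y t| <= r / 2 by apply: H2; rewrite /k !leq_max leqnn !orbT.
have H3 : `|u k s - u k t - Y t * (s - t)| <= e * `|s - t|.
  apply: (@mean_value_norm _ _ _ _ _ _ (fun z _ => uv k z)) => z zs.
  have zd : `|z - t| < d by apply: le_lt_trans sd.
  have zd' : `|z - t| < d' by apply: le_lt_trans sd'.
  have h1 := Hd k z Nk zd.
  have h2 : `|Y z - Y t| <= e / 2.
    by rewrite distrC; apply: Hd'; rewrite /ball /= distrC.
  rewrite -(subrK (Y z) (v k z)) -addrA; apply: le_trans (ler_normD _ _) _; lra.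
have -> : y s - y t - Y t * (s - t) =
   (u k s - u k t - Y t * (s - t)) + ((u k t - y t) - (u k s - y s)) by lra.
apply: le_trans (ler_normD _ _) _; apply: lerD => //.
apply: le_trans (ler_normB _ _) _; lra.
Qed.

End GlobalSolution.

(** * Global solutions of Lipschitz systems *)

Section Picard.
Variable R : realType.
Variables (F : R -> R -> R) (L : R) (x0 y0 : R).
Implicit Types (t s : R) (f : R -> R).
Hypothesis F_lip : forall x y x' y',
  `|F x y - F x' y'| <= L * (`|x - x'| + `|y - y'|).

Let L_ge0 : 0 <= L.
Proof.
have := F_lip 1 0 0 0; rewrite !subrr subr0 normr0 addr0 normr1 mulr1.
by apply: le_trans.
Qed.

Let continuous_F (x y : R -> R) : continuous x -> continuous y ->
  continuous (fun t => F (x t) (y t)).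
Proof.
move=> xc yc t; apply/cvgrPdist_le => e e0.
have e2 : 0 < e / (2 * (L + 1)) by rewrite divr_gt0 // mulr_gt0 // ltr_wpDl.
near=> s.
have h1 : `|x t - x s| <= e / (2 * (L + 1)).
  by near: s; move: (xc t) => /cvgrPdist_le; apply.
have h2 : `|y t - y s| <= e / (2 * (L + 1)).
  by near: s; move: (yc t) => /cvgrPdist_le; apply.
apply: le_trans (F_lip _ _ _ _) _.
apply: (@le_trans _ _ ((L + 1) * (e / (2 * (L + 1)) + e / (2 * (L + 1))))).
  by apply: ler_pM => //; rewrite ?addr_ge0 // ?lerDl // lerD.
have -> // : (L + 1) * (e / (2 * (L + 1)) + e / (2 * (L + 1))) = e.
by field; rewrite gt_eqF // ltr_wpDl.
Unshelve. all: by end_near. Qed.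

(** Total in [f], so that the iteration is a plain [iter]; the default is never met, because all
    iterates are continuous. *)
Let prim (f : R -> R) : R -> R :=
  if pselect (continuous f) is left fc then projT1 (cid (antiderivative fc))
  else cst 0.

Let prim_derive f t : continuous f -> is_derive t 1 (prim f) (f t).
Proof.
by move=> fc; rewrite /prim; case: pselect => // fc'; case: cid.
Qed.

Let prim0 (f : R -> R) (c t : R) : R := prim f t - prim f 0 + c.

Let prim0_derive f c t : continuous f -> is_derive t 1 (prim0 f c) (f t).
Proof.
move=> fc; have := prim_derive t fc => fd.
have : is_derive t 1 (fun s => prim f s + (c - prim f 0)) (f t + 0) by apply: is_deriveD.
by rewrite addr0; congr is_derive; apply/funext => s; rewrite /prim0; ring.
Qed.

Let prim00 f c : prim0 f c 0 = c.
Proof. by rewrite /prim0 subrr add0r. Qed.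

Let step (p : (R -> R) * (R -> R)) : (R -> R) * (R -> R) :=
  (prim0 p.2 x0, prim0 (fun t => F (p.1 t) (p.2 t)) y0).

Let it k := iter k step (cst x0, cst y0).

Let it_continuous k : continuous (it k).1 /\ continuous (it k).2.
Proof.
elim: k => [|k [IH1 IH2]]; first by split=> t; exact: cvg_cst.
split=> t; apply: is_derive_continuous.
  exact: prim0_derive.
by apply: prim0_derive; exact: continuous_F.
Qed.

Let it_derive1 k t : is_derive t 1 (it k.+1).1 ((it k).2 t).
Proof. by apply: prim0_derive; case: (it_continuous k). Qed.

Let it_derive2 k t : is_derive t 1 (it k.+1).2 (F ((it k).1 t) ((it k).2 t)).
Proof. by case: (it_continuous k) => ? ?; apply: prim0_derive; exact: continuous_F. Qed.

Let it0 k : (it k).1 0 = x0 /\ (it k).2 0 = y0.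
Proof. by case: k => [|k] //=; rewrite !prim00. Qed.

(** One step integrates increments bounded by 1 and [L] times the previous ones. Integrating the
    weight [w] costs a factor 1/c, as its primitive [W] satisfies |W| <= w / c; with this [c] the
    total factor (1 + L) / c is 1/2. The weight is even because the solution runs in both
    directions. *)
Let c : R := 2 * (1 + L).
Let w (t : R) : R := expR (c * t) + expR (- (c * t)).
Let W (t : R) : R := (expR (c * t) - expR (- (c * t))) / c.

Let c_gt0 : 0 < c.
Proof. by rewrite mulr_gt0 // ltr_wpDr. Qed.

Let W_derive t : is_derive t 1 W (w t).
Proof.
have d1 : is_derive t 1 (fun t => c * t) c.
  by apply: is_derive_eq; rewrite /GRing.scale /= mulr1.
have d2 : is_derive t 1 (fun t => expR (c * t)) (expR (c * t) * c).
  exact: (@is_derive1_comp _ expR).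
have d3 : is_derive t 1 (fun t => expR (- (c * t))) (expR (- (c * t)) * - c).
  exact: (@is_derive1_comp _ expR).
rewrite /W; apply: is_derive_eq.
rewrite /GRing.scale /= /w; field.
by rewrite gt_eqF.
Qed.

Let W_le t : `|W t| <= w t / c.
Proof.
rewrite /W /w normrM (gtr0_norm (_ : 0 < c^-1)) ?invr_gt0 //.
apply: ler_wpM2r; first by rewrite invr_ge0 ltW.
by apply: le_trans (ler_normB _ _) _; rewrite !gtr0_norm ?expR_gt0.
Qed.

Let w_gt0 t : 0 < w t.
Proof. by rewrite addr_gt0 // expR_gt0. Qed.

Let W_bound (u du : R -> R) K t : u 0 = 0 -> 0 <= K ->
  (forall s, is_derive s 1 u (du s)) -> (forall s, `|du s| <= K * w s) ->
  `|u t| <= K * (w t / c).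
Proof.
move=> u0 K0 ud duK.
have W0 : W 0 = 0 by rewrite /W mulr0 oppr0 subrr mul0r.
have KW s : is_derive s 1 (fun s => K * W s) (K * w s).
  by have := W_derive s => ?; apply: is_derive_eq; rewrite /GRing.scale.
have KWN s : is_derive s 1 (fun s => - (K * W s)) (- (K * w s)).
  by have := KW s => ?; apply: is_deriveN.
have le1 s : du s <= K * w s by apply: le_trans (ler_norm _) (duK s).
have le2 s : - (K * w s) <= du s.
  by have := duK s; rewrite ler_norml => /andP[].
suff : `|u t| <= K * `|W t| by move/le_trans; apply; rewrite ler_wpM2l.
have [t0|t0] := leP 0 t.
  have h1 := derive_le t0 (fun s _ => ud s) (fun s _ => KW s) (fun s _ => le1 s).
  have h2 := derive_le t0 (fun s _ => KWN s) (fun s _ => ud s) (fun s _ => le2 s).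
  rewrite u0 W0 in h1 h2; rewrite ler_norml.
  have := ler_wpM2l K0 (ler_norm (W t)); lra.
have h1 := derive_le (ltW t0) (fun s _ => ud s) (fun s _ => KW s) (fun s _ => le1 s).
have h2 := derive_le (ltW t0) (fun s _ => KWN s) (fun s _ => ud s) (fun s _ => le2 s).
rewrite u0 W0 in h1 h2; rewrite ler_norml.
by have := ler_wpM2l K0 (ler_norm (- W t)); rewrite normrN; lra.
Qed.

(** The first iterate leaves the constants [x0], [y0] with velocities [y0] and [F x0 y0]; since w >=
    1, [A * w] dominates them. *)
Let A : R := `|y0| + `|F x0 y0|.

Let w_ge1 t : 1 <= w t.
Proof.
have := expR_gt0 (c * t); have := expR_gt0 (- (c * t)).
have h1 := expR_ge1Dx (c * t); have h2 := expR_ge1Dx (- (c * t)).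
by rewrite /w; lra.
Qed.

Let it_dist k t :
  `|(it k.+1).1 t - (it k).1 t| + `|(it k.+1).2 t - (it k).2 t| <= A * w t / 2 ^+ k.
Proof.
elim: k t => [|k IH] t.
  rewrite expr0 divr1 /A mulrDl; apply: lerD.
    have := @W_bound (fun t => (it 1).1 t - x0) (fun t => y0 + 0) `|y0| t.
    rewrite (it0 1).1 subrr => /(_ erefl (normr_ge0 _)) H.
    have {}H : `|(it 1).1 t - x0| <= `|y0| * (w t / c).
      apply: H => s; last by rewrite addr0 ler_peMr.
      by have := it_derive1 0 s => ?; apply: is_deriveD.
    apply: le_trans H _; rewrite ler_wpM2l // ler_pdivrMr // ler_peMr ?(ltW (w_gt0 _)) //.
    by have := L_ge0; rewrite /c; lra.
  have := @W_bound (fun t => (it 1).2 t - y0) (fun t => F x0 y0 + 0) `|F x0 y0| t.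
  rewrite (it0 1).2 subrr => /(_ erefl (normr_ge0 _)) H.
  have {}H : `|(it 1).2 t - y0| <= `|F x0 y0| * (w t / c).
    apply: H => s; last by rewrite addr0 ler_peMr.
    by have := it_derive2 0 s => ?; apply: is_deriveD.
  apply: le_trans H _; rewrite ler_wpM2l // ler_pdivrMr // ler_peMr ?(ltW (w_gt0 _)) //.
  by have := L_ge0; rewrite /c; lra.
pose K := A / 2 ^+ k.
have K0 : 0 <= K by rewrite divr_ge0 ?addr_ge0 ?exprn_ge0.
have {}IH s : `|(it k.+1).1 s - (it k).1 s| + `|(it k.+1).2 s - (it k).2 s| <= K * w s.
  by rewrite /K mulrAC.
have h1 : `|(it k.+2).1 t - (it k.+1).1 t| <= K * (w t / c).
  apply: (@W_bound (fun t => (it k.+2).1 t - (it k.+1).1 t)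
    (fun t => (it k.+1).2 t - (it k).2 t)) => //.
  - by rewrite (it0 k.+2).1 (it0 k.+1).1 subrr.
  - by move=> s; have := it_derive1 k.+1 s; have := it_derive1 k s => ? ?; apply: is_deriveB.
  - by move=> s; apply: le_trans (IH s); rewrite lerDr.
have h2 : `|(it k.+2).2 t - (it k.+1).2 t| <= (L * K) * (w t / c).
  apply: (@W_bound (fun t => (it k.+2).2 t - (it k.+1).2 t)
    (fun t => F ((it k.+1).1 t) ((it k.+1).2 t) - F ((it k).1 t) ((it k).2 t))) => //.
  - by rewrite (it0 k.+2).2 (it0 k.+1).2 subrr.
  - by rewrite mulr_ge0.
  - by move=> s; have := it_derive2 k.+1 s; have := it_derive2 k s => ? ?; apply: is_deriveB.
  - by move=> s; apply: le_trans (F_lip _ _ _ _) _; rewrite -mulrA ler_wpM2l.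
apply: le_trans (lerD h1 h2) _.
rewrite le_eqVlt; apply/orP; left; apply/eqP; rewrite /K /c exprS; field.
by rewrite expf_neq0 ?pnatr_eq0 //= gt_eqF // ltr_wpDr.
Qed.

(* Successive approximations contract by 1/2 in the weighted sup norm with
   weight [w]; this gives a solution on the whole line at once. *)
Lemma picard_global : exists x y : R -> R,
  [/\ x 0 = x0, y 0 = y0, forall t, is_derive t 1 x (y t) &
      forall t, is_derive t 1 y (F (x t) (y t))].
Proof.
have cx t : exists l, forall k, `|l - (it k).1 t| <= 2 * (A * w t) / 2 ^+ k.
  apply: near_geometric_cvg => k; apply: le_trans (it_dist k t).
  by rewrite lerDl.
have cy t : exists l, forall k, `|l - (it k).2 t| <= 2 * (A * w t) / 2 ^+ k.
  apply: near_geometric_cvg => k; apply: le_trans (it_dist k t).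
  by rewrite lerDr.
pose x t := projT1 (cid (cx t)); pose y t := projT1 (cid (cy t)).
have xE t k : `|(it k).1 t - x t| <= 2 * (A * w t) / 2 ^+ k.
  by rewrite distrC /x; case: cid.
have yE t k : `|(it k).2 t - y t| <= 2 * (A * w t) / 2 ^+ k.
  by rewrite distrC /y; case: cid.
have A0 : 0 <= A by rewrite addr_ge0.
have pow (C e : R) : 0 < e -> exists N, forall k, (N <= k)%N -> C / 2 ^+ k <= e.
  move=> e0; have [C0|C0] := leP C 0.
    exists 0%N => k _; apply: le_trans (ltW e0).
    by rewrite mulr_le0_ge0 // invr_ge0 exprn_ge0.
  have : (fun k => C / 2 ^+ k : R) @ \oo --> (0 : R).
    have -> : (fun k => C / 2 ^+ k : R) = (fun k => C * 2^-1 ^+ k).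
      by apply/funext => k; rewrite exprVn.
    rewrite -[X in _ --> X](mulr0 C); apply: cvgMr; apply: cvg_expr.
    by rewrite ger0_norm ?invr_ge0 // invf_lt1 // ltr1n.
  move/cvgrPdist_le => /(_ _ e0)[N _ HN]; exists N => k Nk.
  by have := HN k Nk; rewrite sub0r normrN; apply: le_trans; exact: ler_norm.
(* The weight is unbounded, so the iterates converge only locally uniformly; local boundedness of
   [w] is what provides this. *)
have wloc t : exists2 d, 0 < d & forall s, `|s - t| < d -> w s <= w t + 1.
  have : {for t, continuous w}.
    apply: (is_derive_continuous (l := expR (c * t) * c + expR (- (c * t)) * - c)).
    have d1 : is_derive t 1 (fun t => c * t) c.
      by apply: is_derive_eq; rewrite /GRing.scale /= mulr1.
    have d2 : is_derive t 1 (fun t => expR (c * t)) (expR (c * t) * c).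
      exact: (@is_derive1_comp _ expR).
    have d3 : is_derive t 1 (fun t => expR (- (c * t))) (expR (- (c * t)) * - c).
      exact: (@is_derive1_comp _ expR).
    exact: is_deriveD.
  move/cvgrPdist_le => /(_ _ ltr01)[/= d d0 Hd]; exists d => // s.
  by rewrite distrC => /Hd; rewrite ler_norml; lra.
have unif (u : nat -> R -> R) (z : R -> R) (t e : R) : 0 < e ->
    (forall s k, `|u k s - z s| <= 2 * (A * w s) / 2 ^+ k) ->
    exists N, exists2 d, 0 < d & forall k s, (N <= k)%N -> `|s - t| < d ->
     `|u k s - z s| <= e.
  move=> e0 uz; have [N HN] := pow (2 * (A * (w t + 1))) e e0.
  have [d d0 Hd] := wloc t; exists N, d => // k s Nk /Hd ws.
  apply: le_trans (uz s k) _; apply: le_trans (HN k Nk).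
  by rewrite ler_wpM2r ?invr_ge0 ?exprn_ge0 // !ler_wpM2l.
have cont (u : nat -> R -> R) (z : R -> R) :
    (forall s k, `|u k s - z s| <= 2 * (A * w s) / 2 ^+ k) ->
    (forall k, continuous (u k)) -> continuous z.
  move=> uz uc t; apply/cvgrPdist_le => e e0.
  have e3 : 0 < e / 3 by rewrite divr_gt0.
  have [N [d d0 H]] := unif u z t _ e3 uz.
  have := uc N t; move/cvgrPdist_le => /(_ _ e3)[/= d' d'0 Hd'].
  exists (Num.min d d') => /=; first by rewrite lt_min d0.
  move=> s; rewrite /ball_ /= lt_min => /andP[sd sd'].
  have h1 := H N t (leqnn N); rewrite subrr normr0 in h1.
  have {}h1 := h1 d0; have h2 := Hd' s sd'.
  rewrite distrC in sd; have h3 := H N s (leqnn N) sd.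
  have -> : z t - z s = - (u N t - z t) + (u N t - u N s) + (u N s - z s) by lra.
  apply: le_trans (ler_normD _ _) _.
  have := ler_normD (- (u N t - z t)) (u N t - u N s); rewrite normrN; lra.
have xc := cont _ _ xE (fun k => (it_continuous k).1).
have yc := cont _ _ yE (fun k => (it_continuous k).2).
have start (u : nat -> R -> R) (z : R -> R) (z0 : R) :
   (forall s k, `|u k s - z s| <= 2 * (A * w s) / 2 ^+ k) ->
   (forall k, u k 0 = z0) -> z 0 = z0.
  move=> uz uk; apply/eqP; rewrite eq_sym -subr_eq0 -normr_le0; apply/ler_addgt0Pr => e e0.
  have [N [d d0 H]] := unif u z 0 _ e0 uz.
  by rewrite add0r -(uk N); apply: H; rewrite ?subrr ?normr0.
exists x, y; split.
- by apply: start xE _ => k; case: (it0 k).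
- by apply: start yE _ => k; case: (it0 k).
- move=> t; apply: (@is_derive_lim _ (fun k => (it k.+1).1) (fun k => (it k).2)).
  + by move=> k s; exact: it_derive1.
  + move=> s e e0; have [N [d d0 H]] := unif _ _ s _ e0 xE.
    exists N => k Nk; apply: (H k.+1) => //; last by rewrite subrr normr0.
    exact: leq_trans Nk _.
  + by move=> e e0; exact: unif yE.
  + exact: yc.
- move=> t; apply: (@is_derive_lim _ (fun k => (it k.+1).2)
     (fun k s => F ((it k).1 s) ((it k).2 s)) _ (fun s => F (x s) (y s))).
  + by move=> k s; exact: it_derive2.
  + move=> s e e0; have [N [d d0 H]] := unif _ _ s _ e0 yE.
    exists N => k Nk; apply: (H k.+1) => //; last by rewrite subrr normr0.
    exact: leq_trans Nk _.
  + move=> e e0.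
    have e2 : 0 < e / (2 * (L + 1)) by rewrite divr_gt0 // mulr_gt0 // ltr_wpDl.
    have [N [d d0 H]] := unif _ _ t _ e2 xE; have [N' [d' d'0 H']] := unif _ _ t _ e2 yE.
    exists (maxn N N'), (Num.min d d'); first by rewrite lt_min d0.
    move=> k s; rewrite geq_max lt_min => /andP[Nk N'k] /andP[sd sd'].
    apply: le_trans (F_lip _ _ _ _) _.
    have := H k s Nk sd; have := H' k s N'k sd' => h1 h2.
    apply: (@le_trans _ _ ((L + 1) * (e / (2 * (L + 1)) + e / (2 * (L + 1))))).
      by apply: ler_pM => //; rewrite ?addr_ge0 // ?lerDl // lerD.
    have -> // : (L + 1) * (e / (2 * (L + 1)) + e / (2 * (L + 1))) = e.
    by field; rewrite gt_eqF // ltr_wpDl.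
  + exact: continuous_F.
Qed.

End Picard.

(** * The spindle equation *)

Section SpindleEquation.
Variable R : realType.
Implicit Types (t s a b : R).

(** E = u^2 + v^2 satisfies E' <= 2 K (|u| + |v|)^2 <= 4 K E, so E exp(- 4 K t) cannot grow from its
    initial value 0. The sign in [N] turns this into a nondecreasing function. *)
Lemma gronwall_zero (u v du dv : R -> R) (K a b : R) : a <= b ->
  (forall t, a <= t <= b -> is_derive t 1 u (du t)) ->
  (forall t, a <= t <= b -> is_derive t 1 v (dv t)) ->
  (forall t, a <= t <= b -> `|du t| <= K * (`|u t| + `|v t|)) ->
  (forall t, a <= t <= b -> `|dv t| <= K * (`|u t| + `|v t|)) ->
  0 <= K -> u a = 0 -> v a = 0 -> u b = 0 /\ v b = 0.
Proof.
move=> ab ud vd duK dvK K0 ua va.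
pose E t := u t * u t + v t * v t.
pose N t := - (E t * expR (- (4 * K) * t)).
pose dN t := - ((2 * (u t * du t + v t * dv t) - 4 * K * E t) * expR (- (4 * K) * t)).
have Nd t : a <= t <= b -> is_derive t 1 N (dN t).
  move=> abt; have := ud t abt; have := vd t abt => ? ?.
  have d1 : is_derive t 1 (fun t => - (4 * K) * t) (- (4 * K)).
    by apply: is_derive_eq; rewrite /GRing.scale /= mulr1.
  have d2 : is_derive t 1 (fun t => expR (- (4 * K) * t)) (expR (- (4 * K) * t) * - (4 * K)).
    exact: (@is_derive1_comp _ expR).
  by rewrite /N /E; apply: is_derive_eq; rewrite /dN /E /GRing.scale /=; ring.
have dN0 t : a <= t <= b -> 0 <= dN t.
  move=> abt; rewrite /dN -mulNr mulr_ge0 ?expR_ge0 // oppr_ge0 /E.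
  have h1 : u t * du t <= `|u t| * (K * (`|u t| + `|v t|)).
    by apply: le_trans (ler_norm _) _; rewrite normrM ler_wpM2l // duK.
  have h2 : v t * dv t <= `|v t| * (K * (`|u t| + `|v t|)).
    by apply: le_trans (ler_norm _) _; rewrite normrM ler_wpM2l // dvK.
  have -> : u t * u t = `|u t| * `|u t| by rewrite -normrM ger0_norm // -expr2 sqr_ge0.
  have -> : v t * v t = `|v t| * `|v t| by rewrite -normrM ger0_norm // -expr2 sqr_ge0.
  have := mulr_ge0 K0 (sqr_ge0 (`|u t| - `|v t|)); rewrite expr2; nra.
have := derive_ge0_le ab Nd dN0; rewrite /N {1}/E ua va mulr0 addr0 mul0r oppr0 oppr_ge0.
rewrite pmulr_lle0 ?expR_gt0 // /E => h.
have := sqr_ge0 (u b); have := sqr_ge0 (v b); rewrite !expr2 => h1 h2.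
have {}h1 : v b * v b = 0 by lra.
have {}h2 : u b * u b = 0 by lra.
by split; apply/eqP; rewrite -[_ == _]orbb -mulf_eq0; apply/eqP.
Qed.

Lemma coth_derive (x : R) : 0 < x ->
  is_derive x 1 (@coth R) (- 4 / (expR x - expR (- x)) ^+ 2).
Proof.
move=> x0; have lt : expR (- x) < expR x by rewrite ltr_expR; lra.
have d3 : is_derive x 1 (fun t => expR (- t)) (expR (- x) * - 1).
  exact: (@is_derive1_comp _ expR -%R).
have ne : (expR x - expR (- x)) != 0 by rewrite subr_eq0 gt_eqF.
have dV : is_derive x 1 (fun y => (expR y - expR (- y))^-1)
   (- (expR x - expR (- x)) ^- 2 *: (expR x - expR (- x) * - 1)).
  exact: is_deriveV.
rewrite /coth; apply: is_derive_eq.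
have e1 : expR x * expR (- x) = 1 by rewrite expRxMexpNx_1.
rewrite /GRing.scale /= !mulrN1 opprK.
have -> : expR (- x) = (expR x)^-1 by rewrite expRN.
rewrite expRN in ne lt *; field.
have -> : expR x * expR x - 1 = expR x * (expR x - (expR x)^-1).
  by rewrite mulrBr mulfV // gt_eqF // expR_gt0.
by rewrite mulf_neq0 // gt_eqF // expR_gt0.
Qed.

Lemma sinh_le (d x : R) : d <= x -> expR d - expR (- d) <= expR x - expR (- x).
Proof. by move=> dx; apply: lerB; rewrite ler_expR; lra. Qed.

Lemma coth_gt1 (x : R) : 0 < x -> 1 < coth x.
Proof.
move=> x0; have lt : expR (- x) < expR x by rewrite ltr_expR; lra.
rewrite /coth ltr_pdivlMr; first by have := expR_gt0 (- x); lra.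
by rewrite subr_gt0.
Qed.

Lemma coth_le (d x : R) : 0 < d -> d <= x ->
  coth x <= 1 + 2 / (expR d - expR (- d)).
Proof.
move=> d0 dx; have lt : expR (- d) < expR d by rewrite ltr_expR; lra.
have le := sinh_le dx.
have pos : 0 < expR x - expR (- x) by lra.
have -> : coth x = 1 + 2 * expR (- x) / (expR x - expR (- x)).
  by rewrite /coth; field; rewrite gt_eqF.
rewrite lerD2l ler_pM ?mulr_ge0 ?expR_ge0 ?invr_ge0 ?(ltW pos) //.
  by rewrite ler_piMr // -expR0 ler_expR; lra.
by rewrite lef_pV2 // posrE; lra.
Qed.

Lemma coth_lip (d : R) : 0 < d -> exists2 C, 0 <= C & forall x x', d <= x -> d <= x' ->
  `|coth x - coth x'| <= C * `|x - x'|.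
Proof.
move=> d0; have lt : expR (- d) < expR d by rewrite ltr_expR; lra.
pose C := 4 / (expR d - expR (- d)) ^+ 2.
have C0 : 0 <= C by rewrite divr_ge0 // sqr_ge0.
exists C => // x x' dx dx'.
wlog xx : x x' dx dx' / x <= x'.
  by move=> H; case: (leP x x') => [|/ltW] /H; [|rewrite distrC (distrC x)]; apply.
have [|c cb E] := @mean_value _ (@coth R) (fun x => - 4 / (expR x - expR (- x)) ^+ 2) x x' xx.
  by move=> t tb; apply: coth_derive; lra.
rewrite distrC E normrM (distrC x) ler_wpM2r // mulNr normrN.
have cd : d <= c by lra.
have := sinh_le cd => le.
rewrite ger0_norm ?divr_ge0 ?sqr_ge0 // /C ler_wpM2l // lef_pV2 ?posrE ?exprn_gt0 //; try lra.
by rewrite lerXn2r ?nnegrE //; lra.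
Qed.

Definition spindle_rhs (n : nat) (x y : R) : R :=
  (y ^+ 2 - 1) * ((n%:R - 1) * coth x - y).

Lemma spindle_rhs_lip n (d B : R) : 0 < d -> 0 <= B ->
  exists2 L, 0 <= L & forall x y x' y', d <= x -> d <= x' -> `|y| <= B -> `|y'| <= B ->
  `|spindle_rhs n x y - spindle_rhs n x' y'| <= L * (`|x - x'| + `|y - y'|).
Proof.
move=> d0 B0; have [C C0 HC] := coth_lip d0.
have lt : expR (- d) < expR d by rewrite ltr_expR; lra.
pose K : R := 1 + 2 / (expR d - expR (- d)).
have K0 : 0 <= K by rewrite addr_ge0 // divr_ge0 // subr_ge0 ltW.
pose m : R := n%:R - 1.
pose L1 := (B ^+ 2 + 1) * (`|m| * C); pose L2 := 2 * B * (`|m| * K) + 3 * B ^+ 2 + 1.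
have m0 : 0 <= `|m| by [].
have B2 : 0 <= B ^+ 2 by rewrite sqr_ge0.
have L10 : 0 <= L1 by rewrite !mulr_ge0 // addr_ge0.
have L20 : 0 <= L2 by rewrite !addr_ge0 // mulr_ge0 // mulr_ge0.
exists (L1 + L2); first exact: addr_ge0.
move=> x y x' y' dx dx' yB y'B.
(* First x moves at fixed y, then y at fixed x'; the second difference is cubic in y, and y - y'
   factors out. *)
have -> : spindle_rhs n x y - spindle_rhs n x' y' =
  (y ^+ 2 - 1) * (m * (coth x - coth x')) +
  (y - y') * ((y + y') * (m * coth x') - (y ^+ 2 + y * y' + y' ^+ 2) + 1).
  by rewrite /spindle_rhs /m; ring.
have yy : `|y ^+ 2| <= B ^+ 2 by rewrite normrX lerXn2r ?nnegrE.
have y'y' : `|y' ^+ 2| <= B ^+ 2 by rewrite normrX lerXn2r ?nnegrE.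
have yy' : `|y * y'| <= B ^+ 2 by rewrite normrM expr2 ler_pM.
have cK : `|coth x'| <= K.
  by rewrite ger0_norm ?coth_le // ltW // (lt_trans ltr01) // coth_gt1 //; lra.
apply: le_trans (ler_normD _ _) _.
have h1 : `|(y ^+ 2 - 1) * (m * (coth x - coth x'))| <= L1 * `|x - x'|.
  rewrite /L1 !normrM -!mulrA; apply: ler_pM => //.
    by apply: le_trans (ler_normB _ _) _; rewrite normr1 lerD2r.
  by rewrite ler_wpM2l // HC.
have h2 : `|(y - y') * ((y + y') * (m * coth x') - (y ^+ 2 + y * y' + y' ^+ 2) + 1)| <= L2 * `|y - y'|.
  rewrite normrM mulrC ler_wpM2r //.
  apply: le_trans (ler_normD _ _) _; rewrite normr1 lerD2r.
  apply: le_trans (ler_normB _ _) _; apply: lerD.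
    rewrite normrM (normrM m); apply: ler_pM; rewrite ?mulr_ge0 //; last by rewrite ler_wpM2l.
    by apply: le_trans (ler_normD _ _) _; lra.
  apply: le_trans (ler_normD _ _) _; have := ler_normD (y ^+ 2) (y * y'); lra.
have := mulr_ge0 L20 (normr_ge0 (x - x')); have := mulr_ge0 L10 (normr_ge0 (y - y')).
by move=> ? ?; apply: le_trans (lerD h1 h2) _; lra.
Qed.

Lemma segment_bound (f : R -> R) a b : a <= b -> (forall t, a <= t <= b -> {for t, continuous f}) ->
  exists2 B, 0 <= B & forall t, a <= t <= b -> `|f t| <= B.
Proof.
move=> ab fc; have := @EVT_max R (fun t => `|f t|) a b ab => -[].
  apply: continuous_in_subspaceT => t; rewrite inE /= in_itv /= => /fc fct.
  exact: (continuous_comp fct (@norm_continuous _ R^o _)).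
move=> c _ cM; exists `|f c| => // t tab; apply: cM; by rewrite in_itv.
Qed.

Lemma segment_pos (f : R -> R) a b : a <= b -> (forall t, a <= t <= b -> {for t, continuous f}) ->
  (forall t, a <= t <= b -> 0 < f t) ->
  exists2 d, 0 < d & forall t, a <= t <= b -> d <= f t.
Proof.
move=> ab fc f0; have := @EVT_min R f a b ab => -[].
  by apply: continuous_in_subspaceT => t; rewrite inE /= in_itv /= => /fc.
move=> c; rewrite in_itv /= => cab cM; exists (f c); first exact: f0.
by move=> t tab; apply: cM; rewrite in_itv.
Qed.

(** The spindle system x' = y, y' = F(x, y) reparametrized with speed [k]. Along a segment of a
    parameter domain, [k] is the derivative of the time coordinate and has no definite sign. *)
Definition is_flow n (x y k : R -> R) t :=
  [/\ 0 < x t, is_derive t 1 x (y t * k t) & is_derive t 1 y (spindle_rhs n (x t) (y t) * k t)].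

(** By compactness both solutions stay in one region x >= d, |y| <= B, where the right-hand side is
    Lipschitz, and the Gronwall estimate applies. *)
Lemma flow_unique_le n (x y x' y' k : R -> R) a b : a <= b ->
  (forall t, a <= t <= b -> [/\ is_flow n x y k t, is_flow n x' y' k t & {for t, continuous k}]) ->
  x a = x' a -> y a = y' a -> x b = x' b /\ y b = y' b.
Proof.
move=> ab H xa ya.
have [d d0 xd] : exists2 d, 0 < d & forall t, a <= t <= b -> d <= x t.
  by apply: segment_pos => // t /H[[? ? ?] _ _] //; apply: is_derive_continuous.
have [d' d'0 xd'] : exists2 d, 0 < d & forall t, a <= t <= b -> d <= x' t.
  by apply: segment_pos => // t /H[_ [? ? ?] _] //; apply: is_derive_continuous.
have [B B0 yB] : exists2 B, 0 <= B & forall t, a <= t <= b -> `|y t| <= B.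
  by apply: segment_bound => // t /H[[? ? ?] _ _] //; apply: is_derive_continuous.
have [B' B'0 yB'] : exists2 B, 0 <= B & forall t, a <= t <= b -> `|y' t| <= B.
  by apply: segment_bound => // t /H[_ [? ? ?] _] //; apply: is_derive_continuous.
have [C C0 kC] : exists2 B, 0 <= B & forall t, a <= t <= b -> `|k t| <= B.
  by apply: segment_bound => // t /H[].
have e0 : 0 < Num.min d d' by rewrite lt_min d0.
have M0 : 0 <= Num.max B B' by rewrite le_max B0.
have [L L0 HL] := spindle_rhs_lip n e0 M0.
have lip t : a <= t <= b -> `|spindle_rhs n (x t) (y t) - spindle_rhs n (x' t) (y' t)| <=
     L * (`|x t - x' t| + `|y t - y' t|).
  move=> abt; apply: HL; rewrite ?ge_min ?le_max ?xd ?xd' ?yB ?yB' ?orbT //.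
pose f t := x t - x' t; pose g t := y t - y' t.
have [|||||||/eqP fb /eqP gb] := @gronwall_zero f g (fun t => (y t - y' t) * k t)
  (fun t => (spindle_rhs n (x t) (y t) - spindle_rhs n (x' t) (y' t)) * k t) ((L + 1) * C) a b ab.
- by move=> t /H[[_ ? _] [_ ? _] _]; rewrite mulrBl; apply: is_deriveB.
- by move=> t /H[[_ _ ?] [_ _ ?] _]; rewrite mulrBl; apply: is_deriveB.
- move=> t abt; rewrite normrM mulrAC; apply: ler_pM => //; last exact: kC.
  rewrite mulrDl mul1r -/(f t) -/(g t).
  have := mulr_ge0 L0 (addr_ge0 (normr_ge0 (f t)) (normr_ge0 (g t))).
  have := normr_ge0 (f t); lra.
- move=> t abt; rewrite normrM mulrAC; apply: ler_pM => //; last exact: kC.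
  apply: le_trans (lip t abt) _; rewrite mulrDl mul1r lerDl.
  by rewrite addr_ge0.
- by rewrite mulr_ge0 // addr_ge0.
- by rewrite /f xa subrr.
- by rewrite /g ya subrr.
by move: fb gb; rewrite !subr_eq0 => /eqP -> /eqP ->.
Qed.

(** Reversal is absorbed by the sign of the speed, so backward uniqueness follows from the forward
    one. *)
Lemma flow_flip n (x y k : R -> R) t : is_flow n x y k (- t) ->
  is_flow n (fun s => x (- s)) (fun s => y (- s)) (fun s => - k (- s)) t.
Proof.
move=> [x0 xd yd]; split => //; rewrite mulrN; exact: is_derive_flip.
Qed.

Lemma flow_unique n (x y x' y' k : R -> R) a b :
  (forall t, Num.min a b <= t <= Num.max a b ->
    [/\ is_flow n x y k t, is_flow n x' y' k t & {for t, continuous k}]) ->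
  x a = x' a -> y a = y' a -> x b = x' b /\ y b = y' b.
Proof.
have [ab|/ltW ba] := leP a b; first exact: flow_unique_le.
move=> H xa ya.
have := @flow_unique_le n (fun s => x (- s)) (fun s => y (- s)) (fun s => x' (- s))
  (fun s => y' (- s)) (fun s => - k (- s)) (- a) (- b).
rewrite !opprK lerN2 => /(_ ba); apply => // t tab.
have [|h1 h2 h3] := H (- t); first by lra.
split; [exact: flow_flip|exact: flow_flip|].
apply: (@continuous_comp _ _ _ (fun s : R => k (- s)) -%R); last exact: opp_continuous.
by apply: (@continuous_comp _ _ _ -%R k) => //; exact: opp_continuous.
Qed.

End SpindleEquation.

(** * Gluing solutions, and running a solution to its maximum *)

Section SpindleSolutions.
Variables (R : realType) (n : nat).
Implicit Types (t s a b : R) (J K : set R) (g h : R -> R).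

(** [spindle_solution] without its initial condition, so that solutions with different data [t0],
    [g0] can be compared and glued. *)
Definition spindle_flow J g :=
  [/\ open J, is_interval J &
      forall t, J t ->
        [/\ 0 < g t, derivable g t 1, derivable (derive1 g) t 1 &
            derive1 (derive1 g) t = spindle_rhs n (g t) (derive1 g t)]].

Lemma spindle_solutionP t0 (g0 : R) J g : spindle_solution n t0 g0 J g <->
  [/\ spindle_flow J g, J t0, g t0 = g0 & derive1 g t0 = 0].
Proof. by split=> [[? ? ? [? ?] ?]|[[? ? ?] ? ? ?]]; split. Qed.

Lemma spindle_flow_is_flow J g t : spindle_flow J g -> J t ->
  is_flow n g (derive1 g) (cst 1) t.
Proof.
move=> [_ _ H] /H[g0 gd g'd E].
have d1 : is_derive t 1 g (derive1 g t) by rewrite derive1E; exact: (derivableP gd).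
have d2 : is_derive t 1 (derive1 g) (derive1 (derive1 g) t).
  by rewrite [X in is_derive _ _ _ X]derive1E; exact: (derivableP g'd).
by rewrite E in d2; split; [exact: g0|rewrite /= mulr1; exact: d1|rewrite /= mulr1; exact: d2].
Qed.

Lemma interval_minmax J a b t : is_interval J -> J a -> J b ->
  Num.min a b <= t <= Num.max a b -> J t.
Proof.
move=> Ji Ja Jb; have [ab|ba] := leP a b; first exact: Ji Ja Jb _.
exact: Ji Jb Ja _.
Qed.

Lemma spindle_flow_unique J K g h a b : spindle_flow J g -> spindle_flow K h ->
  J a -> K a -> J b -> K b -> g a = h a -> derive1 g a = derive1 h a ->
  g b = h b /\ derive1 g b = derive1 h b.
Proof.
move=> gJ hK Ja Ka Jb Kb; apply: (@flow_unique _ n _ _ _ _ (cst 1)) => t abt.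
have [[_ Ji _] [_ Ki _]] := (gJ, hK).
split; last exact: cst_continuous.
  by apply: (spindle_flow_is_flow gJ); exact: interval_minmax abt.
by apply: (spindle_flow_is_flow hK); exact: interval_minmax abt.
Qed.

Lemma near_eq_derive1 (g h : R -> R) t : (\near t, g t = h t) -> derive1 g t = derive1 h t.
Proof. by move=> gh; rewrite !derive1E; exact: near_eq_derive. Qed.

Lemma near_derive1_eq (g h : R -> R) t :
  (\near t, g t = h t) -> \near t, derive1 g t = derive1 h t.
Proof.
move=> /nbhs_interior gh; apply: filterS gh => s; exact: near_eq_derive1.
Qed.

(** Because [g] and [h] agree on the overlap, the glued function equals one of them on an open set
    around each point, and no seam has to be examined. A common point makes the union an
    interval. *)
Lemma spindle_flow_union J K g h : spindle_flow J g -> spindle_flow K h ->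
  J `&` K !=set0 -> (forall t, J t -> K t -> g t = h t) ->
  exists f, [/\ spindle_flow (J `|` K) f, (forall t, J t -> f t = g t) &
                forall t, K t -> f t = h t].
Proof.
move=> [Jo Ji gJ] [Ko Ki hK] [c [Jc Kc]] gh.
pose f t := if pselect (J t) then g t else h t.
have fg t : J t -> f t = g t by rewrite /f; case: pselect.
have fh t : K t -> f t = h t by rewrite /f; case: pselect => //= Jt Kt; exact: gh.
exists f; split => //; split; first exact: openU.
- have sub L : is_interval L -> L c -> forall x z, L x -> x <= z <= c \/ c <= z <= x -> L z.
    by move=> Li Lc x z Lx [xzc|xzc]; [exact: Li Lx Lc z xzc|exact: Li Lc Lx z xzc].
  move=> x y JKx JKy z xzy; have [zc|cz] := leP z c.
    case: JKx => Lx; [left; apply: (sub J Ji Jc x)|right; apply: (sub K Ki Kc x)] => //;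
      left; lra.
  case: JKy => Ly; [left; apply: (sub J Ji Jc y)|right; apply: (sub K Ki Kc y)] => //;
      right; lra.
- have transfer L k t : open L -> L t -> (forall s, L s -> f s = k s) ->
    [/\ 0 < k t, derivable k t 1, derivable (derive1 k) t 1 &
            derive1 (derive1 k) t = spindle_rhs n (k t) (derive1 k t)] ->
    [/\ 0 < f t, derivable f t 1, derivable (derive1 f) t 1 &
            derive1 (derive1 f) t = spindle_rhs n (f t) (derive1 f t)].
    move=> Lo Lt fk [k0 kd kdd E].
    have fkn : \near t, f t = k t by apply: filterS fk _; exact: open_nbhs_nbhs.
    have kfn : \near t, k t = f t by apply: filterS fkn => s ->.
    have k'fn := near_derive1_eq kfn; have f'kn := near_derive1_eq fkn.
    split; first by rewrite fk.
    + exact: near_eq_derivable kd.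
    + exact: near_eq_derivable kdd.
    + by rewrite (near_eq_derive1 f'kn) (near_eq_derive1 fkn) fk.
  move=> t [Jt|Kt]; first by apply: (transfer J g) => //; exact: gJ.
  by apply: (transfer K h) => //; exact: hK.
Qed.

Definition clamp (y : R) : R := Num.max (- 1) (Num.min y 1).

Lemma max_lip (d x x' : R) : `|Num.max x d - Num.max x' d| <= `|x - x'|.
Proof.
rewrite ler_norml; have h1 := ler_norm (x - x').
have h2 := ler_norm (- (x - x')); rewrite normrN in h2.
have h0 := normr_ge0 (x - x').
by have [?|?] := leP x d; have [?|?] := leP x' d; apply/andP; split; lra.
Qed.

Lemma min_lip (d x x' : R) : `|Num.min x d - Num.min x' d| <= `|x - x'|.
Proof.
rewrite ler_norml; have h1 := ler_norm (x - x').
have h2 := ler_norm (- (x - x')); rewrite normrN in h2.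
have h0 := normr_ge0 (x - x').
by have [?|?] := leP x d; have [?|?] := leP x' d; apply/andP; split; lra.
Qed.

Lemma clamp_lip (y y' : R) : `|clamp y - clamp y'| <= `|y - y'|.
Proof.
rewrite /clamp !(maxC (- 1)).
by apply: le_trans (max_lip _ _ _) _; exact: min_lip.
Qed.

Lemma clamp_le1 (y : R) : `|clamp y| <= 1.
Proof.
by rewrite ler_norml /clamp le_max lexx /= ge_max ge_min lexx orbT andbT; lra.
Qed.

Lemma clamp_id (y : R) : `|y| <= 1 -> clamp y = y.
Proof.
by rewrite ler_norml /clamp => /andP[y0 y1]; rewrite min_l // max_r.
Qed.

Hypothesis n_ge2 : (2 <= n)%N.

(** Here the dimension enters the equation: for n >= 2, (n - 1) coth x > 1. So the second factor of
    the right-hand side is positive when y < 1, and solutions with |y| < 1 are concave. *)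
Lemma spindle_factor_ge (x y s : R) : 0 < x -> y <= s -> 1 - s <= (n%:R - 1) * coth x - y.
Proof.
move=> x0 ys; have c1 := coth_gt1 x0.
have : 2 <= n%:R :> R by rewrite ler_nat.
move=> n2; have : 0 <= (n%:R - 1 - 1) * coth x :> R by rewrite mulr_ge0; lra.
lra.
Qed.

(* The equation is truncated outside [x >= x0 / 2], [`|y| <= 1] so as to be
   globally Lipschitz.  On the way to the zero of y neither |y| grows nor does
   x drop below x0, so the truncation is never felt there. *)
Lemma spindle_exists (t1 x0 s0 : R) : 0 < x0 -> `|s0| < 1 ->
  exists t0 (g0 : R) J g,
    [/\ 0 < g0, spindle_solution n t0 g0 J g, J t1, g t1 = x0 & derive1 g t1 = s0].
Proof.
move=> x00 s01; pose d := x0 / 2.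
have d0 : 0 < d by rewrite divr_gt0.
pose F x y := spindle_rhs n (Num.max x d) (clamp y).
have [L L0 HL] := spindle_rhs_lip n d0 ler01.
have Flip x y x' y' : `|F x y - F x' y'| <= L * (`|x - x'| + `|y - y'|).
  apply: le_trans (HL _ _ _ _ _ _ (clamp_le1 _) (clamp_le1 _)) _; rewrite ?le_max ?lexx ?orbT //.
  by rewrite ler_wpM2l // lerD ?max_lip ?clamp_lip.
have [X [Y [X0 Y0 Xd Yd]]] := picard_global x0 s0 Flip.
have maxd x : 0 < Num.max x d by rewrite lt_max d0 orbT.
(* A lower bound for the deceleration -F while |y| <= |s0|: each factor bounds the corresponding
   factor of the equation. *)
pose c := (1 - s0 ^+ 2) * (1 - `|s0|).
have s02 : s0 ^+ 2 < 1 by rewrite -real_normK ?num_real // expr_lt1.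
have c0 : 0 < c by rewrite mulr_gt0 // subr_gt0.
(* Thanks to the clamping, the sign holds on the whole plane, so [Y] is monotone before anything is
   known about its range. *)
have F_le0 x y : F x y <= 0.
  rewrite /F /spindle_rhs mulr_le0_ge0 //.
    by rewrite subr_le0 -real_normK ?num_real // expr_le1 // clamp_le1.
  have := spindle_factor_ge (maxd x) (le_trans (ler_norm _) (clamp_le1 y)); lra.
have F_le x y : `|y| <= `|s0| -> F x y <= - c.
  move=> ys; rewrite /F /spindle_rhs clamp_id; last by rewrite (le_trans ys) // ltW.
  have h1 := spindle_factor_ge (maxd x) (le_trans (ler_norm _) ys).
  have h2 : y ^+ 2 <= s0 ^+ 2.
    by rewrite -(real_normK (num_real y)) -(real_normK (num_real s0)) lerXn2r ?nnegrE.
  rewrite -lerN2 opprK -mulNr opprB /c; apply: ler_pM; lra.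
have Ynincr a b : a <= b -> Y b <= Y a.
  move=> ab; have := @derive_le _ Y (cst 0) (fun t => F (X t) (Y t)) (cst 0) a b ab.
  by rewrite subrr subr_le0; apply.
have Yc t : {for t, continuous Y} by exact: is_derive_continuous (Yd t).
have Xc t : {for t, continuous X} by exact: is_derive_continuous (Xd t).
(* Were the zero of [Y] not reached within time [T], [Y] would have changed by at least 2 there
   while staying within |s0| < 1 of zero. *)
pose T := 2 / c.
have T0 : 0 < T by rewrite divr_gt0.
have cT : c * T = 2 by rewrite /T mulrCA mulfV ?mulr1 // gt_eqF.
have s0N := ler_norm s0; have s0N' := ler_norm (- s0); rewrite normrN in s0N'.
have within a b : {within `[a, b], continuous Y}.
  by apply: continuous_in_subspaceT => t _; exact: Yc.
have [z [z0 Yz Xz]] : exists z, [/\ Y z = 0,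
    (forall t, Num.min 0 z <= t <= Num.max 0 z -> `|Y t| <= `|s0|) &
    (forall t, Num.min 0 z <= t <= Num.max 0 z -> x0 <= X t)].
  have [s0p|s0n] := leP 0 s0.
    have YT : Y T <= 0.
      rewrite leNgt; apply/negP => YT.
      have := @derive_le _ Y (fun t => - c * t) (fun t => F (X t) (Y t)) (cst (- c)) 0 T (ltW T0).
      rewrite Y0 mulr0 subr0; suff H : Y T - s0 <= - c * T -> False.
        move=> H'; apply: H; apply: H' => // t tT.
          by apply: is_derive_eq; rewrite /GRing.scale /= mulr1.
        have h1 : Y T <= Y t by apply: Ynincr; lra.
        have h2 : Y t <= Y 0 by apply: Ynincr; lra.
        by apply: F_le; rewrite !ger0_norm //; lra.
      by rewrite mulNr cT; lra.
    have [||z] := @IVT R Y 0 T 0 (ltW T0); first exact: within.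
      by rewrite Y0 ge_min YT orbT le_max s0p.
    rewrite in_itv /= => /andP[z0 zT] Yz; exists z.
    rewrite min_l // max_r //.
    have Yb t : 0 <= t <= z -> 0 <= Y t <= s0.
      move=> tz; have h1 : Y z <= Y t by apply: Ynincr; lra.
      have h2 : Y t <= Y 0 by apply: Ynincr; lra.
      lra.
    split => // t tz; first by have := Yb t tz => ?; rewrite !ger0_norm; lra.
    rewrite -X0; apply: (@derive_ge0_le _ X Y _ _ _ (fun u _ => Xd u)) => [|u ub]; first lra.
    have /Yb : 0 <= u <= z by lra.
    lra.
  (* For negative initial slope the maximum lies in the past, and the same estimate is run
     backwards. *)
  have YT : 0 <= Y (- T).
    rewrite leNgt; apply/negP => YT.
    have T0' : - T <= 0 by lra.
    have := @derive_le _ Y (fun t => - c * t) (fun t => F (X t) (Y t)) (cst (- c)) (- T) 0 T0'.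
    rewrite Y0 mulr0; suff H : s0 - Y (- T) <= 0 - - c * - T -> False.
      move=> H'; apply: H; apply: H' => // t tT.
        by apply: is_derive_eq; rewrite /GRing.scale /= mulr1.
      have h1 : Y t <= Y (- T) by apply: Ynincr; lra.
      have h2 : Y 0 <= Y t by apply: Ynincr; lra.
      by apply: F_le; rewrite !ler0_norm //; lra.
    by rewrite mulrNN cT; lra.
  have T0' : - T <= 0 by lra.
  have [||z] := @IVT R Y (- T) 0 0 T0'; first exact: within.
    by rewrite Y0 ge_min le_max YT (ltW s0n) orbT.
  rewrite in_itv /= => /andP[zT z0] Yz; exists z.
  rewrite min_r // max_l //.
  have Yb t : z <= t <= 0 -> s0 <= Y t <= 0.
    move=> tz; have h1 : Y t <= Y z by apply: Ynincr; lra.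
    have h2 : Y 0 <= Y t by apply: Ynincr; lra.
    lra.
  split => // t tz; first by have := Yb t tz => ?; rewrite !ler0_norm; lra.
  rewrite -X0 -[X 0]opprK -[X t]opprK lerN2.
  have XNd (u : R) : is_derive u 1 (fun u => - X u) (- Y u) by have := Xd u => ?; exact: is_deriveN.
  apply: (@derive_ge0_le _ _ _ _ _ _ (fun u _ => XNd u)) => [|u ub]; first lra.
  have /Yb : z <= u <= 0 by lra.
  lra.
have good u : Num.min 0 z <= u <= Num.max 0 z -> exists2 e : R, 0 < e &
    forall t, `|t - u| < e -> d < X t /\ `|Y t| < 1.
  move=> ub; have xu := Xz u ub; have yu := Yz u ub.
  have e1 : 0 < X u - d by rewrite /d; lra.
  have e2 : 0 < 1 - `|Y u| by lra.
  have := Xc u; move/cvgrPdist_lt => /(_ _ e1)[/= r1 r10 H1].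
  have := Yc u; move/cvgrPdist_lt => /(_ _ e2)[/= r2 r20 H2].
  exists (Num.min r1 r2); first by rewrite lt_min r10.
  move=> t; rewrite lt_min distrC => /andP[/H1 + /H2].
  rewrite ltr_norml => h1 h2; split; first by lra.
  have := ler_normD (Y u) (- (Y u - Y t)); rewrite normrN.
  have -> : Y u + - (Y u - Y t) = Y t by lra.
  lra.
have [e1 e10 G1] : exists2 e : R, 0 < e &
    forall t, `|t - Num.min 0 z| < e -> d < X t /\ `|Y t| < 1.
  by apply: good; rewrite lexx /= ge_min !le_max lexx.
have [e2 e20 G2] : exists2 e : R, 0 < e &
    forall t, `|t - Num.max 0 z| < e -> d < X t /\ `|Y t| < 1.
  by apply: good; rewrite lexx andbT ge_min !le_max lexx.
(* The domain has to be open, so the segment between 0 and [z] is widened by a margin on which d < X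
   and |Y| < 1 persist and the truncation is still inactive. *)
pose lo := Num.min 0 z - Num.min e1 e2; pose hi := Num.max 0 z + Num.min e1 e2.
have e0 : 0 < Num.min e1 e2 by rewrite lt_min e10.
have ee1 : Num.min e1 e2 <= e1 by rewrite ge_min lexx.
have ee2 : Num.min e1 e2 <= e2 by rewrite ge_min lexx orbT.
have mM : Num.min 0 z <= Num.max 0 z by rewrite ge_min !le_max lexx.
have m0 : Num.min 0 z <= 0 <= Num.max 0 z by rewrite ge_min le_max lexx.
have mz : Num.min 0 z <= z <= Num.max 0 z by rewrite ge_min le_max lexx !orbT.
have region t : lo < t < hi -> d < X t /\ `|Y t| < 1.
  rewrite /lo /hi => tb; have [tm|tm] := ltP t (Num.min 0 z).
    by apply: G1; rewrite ltr_norml; lra.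
  have [tM|tM] := ltP (Num.max 0 z) t.
    by apply: G2; rewrite ltr_norml; lra.
  have tt : Num.min 0 z <= t <= Num.max 0 z by rewrite tm.
  by have := Xz t tt; have := Yz t tt; rewrite /d => ? ?; split; lra.
pose J : set R := [set` `]lo + t1, hi + t1[]; pose g t := X (t - t1).
have gd t : is_derive t 1 g (Y (t - t1)) by apply: is_derive_shift_arg; exact: Xd.
have g'E : derive1 g = fun t => Y (t - t1).
  by apply/funext => t; rewrite derive1E; have [_ ->] := gd t.
have g'd t : is_derive t 1 (derive1 g) (F (X (t - t1)) (Y (t - t1))).
  by rewrite g'E; apply: is_derive_shift_arg; exact: Yd.
have JE t : J t = (lo + t1 < t < hi + t1) :> Prop by rewrite /J /= in_itv.
exists (z + t1), (X z), J, g; split.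
- by have := Xz z mz; lra.
- apply/spindle_solutionP; split.
  + split; [exact: interval_open|exact: interval_is_interval|].
    move=> t; rewrite JE => tJ.
    have [|r1 r2] := region (t - t1); first by lra.
    split; first by rewrite /g; lra.
    * by have [] := gd t.
    * by have [] := g'd t.
    * rewrite derive1E; have [_ ->] := g'd t.
      by rewrite g'E /F /g max_l ?clamp_id // ltW.
  + by rewrite JE; rewrite /lo /hi; lra.
  + by rewrite /g addrK.
  + by rewrite g'E addrK.
- by rewrite JE; rewrite /lo /hi; lra.
- by rewrite /g subrr.
- by rewrite g'E subrr.
Qed.

End SpindleSolutions.

(** * Maximal solutions *)

Section SpindleMaximal.
Variables (R : realType) (n : nat).
Implicit Types (t s a b : R) (J K : set R) (g h : R -> R).

(** The domain is the union of the domains of all solutions with the same data. Uniqueness makes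
    their values agree, and the union is an interval because every domain contains [t0]. *)
Lemma spindle_maximal t0 (g0 : R) J g : spindle_solution n t0 g0 J g ->
  exists J' g', [/\ maximal_spindle_solution n t0 g0 J' g', J `<=` J' &
    forall t, J t -> g' t = g t /\ derive1 g' t = derive1 g t].
Proof.
move=> gJ.
pose J' : set R := [set t | exists K h, spindle_solution n t0 g0 K h /\ K t].
have agree K h K' h' t : spindle_solution n t0 g0 K h -> spindle_solution n t0 g0 K' h' ->
    K t -> K' t -> h t = h' t /\ derive1 h t = derive1 h' t.
  move=> /spindle_solutionP[sK Kt0 ht0 h't0] /spindle_solutionP[sK' K't0 h't0' h't0''] Kt K't.
  apply: (spindle_flow_unique sK sK' Kt0 K't0) => //; first by rewrite ht0.
  by rewrite h't0.
have ex t : exists r, forall K h, spindle_solution n t0 g0 K h -> K t -> h t = r.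
  have [[K' [h' [sK' K't]]]|nJ] := pselect (J' t).
    by exists (h' t) => K h sK Kt; exact: (agree K h K' h' t sK sK' Kt K't).1.
  by exists 0 => K h sK Kt; case: nJ; exists K, h.
pose g' t := projT1 (cid (ex t)).
have g'E K h t : spindle_solution n t0 g0 K h -> K t -> g' t = h t.
  by move=> sK Kt; apply/esym; exact: (projT2 (cid (ex t)) K h sK Kt).
have g'near K h t : spindle_solution n t0 g0 K h -> K t -> \near t, g' t = h t.
  move=> sK Kt; have [Ko _ _ _ _] := sK.
  by apply: filterS (fun s => g'E K h s sK) _; exact: open_nbhs_nbhs.
have hnear K h t : spindle_solution n t0 g0 K h -> K t -> \near t, h t = g' t.
  by move=> sK Kt; apply: filterS (g'near K h t sK Kt) => s ->.
have Jt0 : J t0 by case: gJ.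
have sol' : spindle_solution n t0 g0 J' g'.
  apply/spindle_solutionP; split; [split| | |].
  - rewrite openE => t [K [h [sK Kt]]]; have [Ko _ _ _ _] := sK.
    have : nbhs t K by exact: open_nbhs_nbhs.
    by apply: filterS => s Ks; exists K, h.
  - move=> x y [K [h [sK Kx]]] [K' [h' [sK' K'y]]] z xzy.
    have [_ Ki Kt0 _ _] := sK; have [_ K'i K't0 _ _] := sK'.
    have [zt|tz] := leP z t0.
      by exists K, h; split => //; apply: Ki Kx Kt0 _ _; lra.
    by exists K', h'; split => //; apply: K'i K't0 K'y _ _; lra.
  - move=> t [K [h [sK Kt]]]; have [_ _ _ _ /(_ t Kt)[h0 hd hdd E]] := sK.
    have hn := hnear K h t sK Kt; have h'n := near_derive1_eq hn.
    have gn := g'near K h t sK Kt; have g'n := near_derive1_eq gn.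
    split; first by rewrite (g'E K h).
    + exact: near_eq_derivable hd.
    + exact: near_eq_derivable hdd.
    + by rewrite (near_eq_derive1 g'n) (near_eq_derive1 gn) (g'E K h).
  - by exists J, g.
  - by rewrite (g'E J g) //; case: gJ => _ _ _ [].
  - by rewrite (near_eq_derive1 (g'near J g t0 gJ Jt0)); case: gJ => _ _ _ [].
exists J', g'; split.
- split => // K h sK J'K _; rewrite eqEsubset; split => // t Kt; by exists K, h.
- by move=> t Jt; exists J, g.
- by move=> t Jt; rewrite (g'E J g) // (near_eq_derive1 (g'near J g t gJ Jt)).
Qed.

End SpindleMaximal.

(** * Rotations and hyperplanes *)

Section LinearAlgebra.

(** One block matrix is factored into triangular ones in two ways, by eliminating either of its
    diagonal blocks. It gives determinant -1 for reflections. *)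
Lemma det_rank1_update (F : fieldType) n (u : 'cV[F]_n) (v : 'rV[F]_n) :
  \det (1%:M - u *m v) = 1 - (v *m u) 0 0.
Proof.
pose A := block_mx 1%:M u v (1%:M : 'M[F]_1).
have E1 : A = block_mx 1%:M 0 v 1%:M *m block_mx 1%:M u 0 (1%:M - v *m u).
  by rewrite mulmx_block !mul1mx !mul0mx ?mulmx1 ?mulmx0 !addr0 addrC subrK.
have E2 : A = block_mx (1%:M - u *m v) u 0 1%:M *m block_mx 1%:M 0 v 1%:M.
  by rewrite mulmx_block !mul1mx !mul0mx !mulmx1 ?mulmx0 !add0r subrK.
have := congr1 determinant E1; rewrite E2 !det_mulmx !det_lblock !det_ublock !det1.
by rewrite !mul1r !mulr1 => ->; rewrite det_mx11 !mxE eqxx.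
Qed.

(** Any nonzero column of the cokernel matrix works: its kernel contains the row space of [N], and
    both have rank n. *)
Lemma hyperplane_of_row_free (F : fieldType) n (N : 'M[F]_(n, n + 1)) :
  row_free N -> exists2 c : 'cV[F]_(n + 1), c != 0 &
    forall y : 'rV_(n + 1), y *m c = 0 <-> exists u, y = u *m N.
Proof.
move=> Nf; have rN : \rank N = n by apply/eqP.
have : cokermx N != 0.
  by rewrite -mxrank_eq0 mxrank_coker rN addKn.
move=> cN; have [j cj] : exists j, col j (cokermx N) != 0.
  apply: contrapT => H; case/negP: cN; apply/eqP/matrixP => i j.
  have : col j (cokermx N) = 0.
    by apply/eqP/negPn/negP => cj; apply: H; exists j.
  by move/matrixP/(_ i 0); rewrite !mxE.
exists (col j (cokermx N)) => //; set c := col j _.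
have Nc : N *m c = 0 by rewrite /c colE mulmxA mulmx_coker mul0mx.
have Nk : (N <= kermx c)%MS by apply/sub_kermxP.
have rk : \rank (kermx c) = n.
  rewrite mxrank_ker -mxrank_tr rank_rV; have -> : c^T != 0 by rewrite trmx_eq0.
  by rewrite addnK.
move=> y; split=> [yc|[u ->]]; last by rewrite -mulmxA Nc mulmx0.
have yk : (y <= kermx c)%MS by apply/sub_kermxP.
have : (kermx c <= N)%MS by rewrite -(mxrank_leqif_sup Nk).2 rN rk.
by move=> /(submx_trans yk)/submxP[u ->]; exists u.
Qed.

Lemma other_index n (n_ge2 : (2 <= n)%N) (i : 'I_n) : exists j : 'I_n, j != i.
Proof.
have n0 : (0 < n)%N by apply: leq_trans n_ge2.
have [i0|i0] := eqVneq (i : nat) 0%N.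
  by exists (Ordinal n_ge2); rewrite -val_eqE /= i0.
by exists (Ordinal n0); rewrite -val_eqE /= eq_sym.
Qed.

Variables (R : realType) (n : nat).
Implicit Types (x y z : 'rV[R]_n).

Definition dot x y : R := \sum_i x 0 i * y 0 i.

Lemma mulmx_tr_dot x y : x *m y^T = (dot x y)%:M.
Proof.
rewrite [LHS]mx11_scalar; congr (_%:M).
by rewrite !mxE; apply: eq_bigr => i _; rewrite mxE.
Qed.

Lemma dotC x y : dot x y = dot y x.
Proof. by apply: eq_bigr => i _; rewrite mulrC. Qed.

Lemma dotDl x y z : dot (x + y) z = dot x z + dot y z.
Proof. by rewrite -big_split; apply: eq_bigr => i _; rewrite mxE mulrDl. Qed.

Lemma dotZl (a : R) x y : dot (a *: x) y = a * dot x y.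
Proof. by rewrite /dot mulr_sumr; apply: eq_bigr => i _; rewrite mxE mulrA. Qed.

Lemma dotNl x y : dot (- x) y = - dot x y.
Proof. by rewrite -scaleN1r dotZl mulN1r. Qed.

Lemma dotDr x y z : dot z (x + y) = dot z x + dot z y.
Proof. by rewrite dotC dotDl !(dotC z). Qed.

Lemma dotZr (a : R) x y : dot x (a *: y) = a * dot x y.
Proof. by rewrite dotC dotZl dotC. Qed.

Lemma dotNr x y : dot x (- y) = - dot x y.
Proof. by rewrite dotC dotNl dotC. Qed.

Lemma dot_ge0 x : 0 <= dot x x.
Proof. by apply: sumr_ge0 => i _; rewrite -expr2 sqr_ge0. Qed.

Lemma dot_eq0 x : (dot x x == 0) = (x == 0).
Proof.
apply/eqP/eqP => [x0|->]; last by rewrite /dot big1 // => i _; rewrite mxE mul0r.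
apply/rowP => i; rewrite mxE; apply/eqP; rewrite -[_ == 0]orbb -mulf_eq0.
by apply/eqP; apply: (psumr_eq0P _ x0) => // j _; rewrite -expr2 sqr_ge0.
Qed.

Lemma dot_delta x (k : 'I_n) : dot x (delta_mx 0 k) = x 0 k.
Proof.
rewrite /dot (bigD1 k) //= big1 ?addr0 => [|m mk]; first by rewrite !mxE !eqxx mulr1.
by rewrite !mxE (negbTE mk) andbF mulr0.
Qed.

Lemma row_neq0P x : x != 0 -> exists i, x 0 i != 0.
Proof.
move=> x0; apply: contrapT => H; case/negP: x0; apply/eqP/rowP => i; rewrite mxE.
by apply/eqP/negPn/negP => xi; apply: H; exists i.
Qed.

Lemma dot_cauchy_schwarz x y : dot x y ^+ 2 <= dot x x * dot y y.
Proof.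
have [->|y0] := eqVneq y 0.
  by rewrite -(scale0r 0) !dotZr !mul0r mulr0 expr0n.
have yp : 0 < dot y y by rewrite lt_neqAle dot_ge0 eq_sym dot_eq0 y0.
have := dot_ge0 (dot y y *: x - dot x y *: y).
rewrite !(dotDl, dotDr, dotNl, dotNr, dotZl, dotZr) (dotC y x).
set a := dot x x; set b := dot x y; set c := dot y y in yp *.
move=> H; have {H} : 0 <= c * (a * c - b ^+ 2) by lra.
by rewrite pmulr_rge0 // subr_ge0.
Qed.

(** The Householder reflection in the hyperplane orthogonal to [z], acting on row vectors; [z] is
    not normalized, which avoids square roots. *)
Definition reflection z : 'M[R]_n := 1%:M - ((2 / dot z z) *: z^T) *m z.

Lemma mul_reflection x z : x *m reflection z = x - (2 * dot x z / dot z z) *: z.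
Proof.
rewrite mulmxBr mulmx1 -scalemxAl -scalemxAr mulmxA mulmx_tr_dot mul_scalar_mx scalerA.
by congr (_ - _ *: _); rewrite mulrAC.
Qed.

Lemma reflection_tr z : (reflection z)^T = reflection z.
Proof.
by rewrite /reflection linearB /= tr_scalar_mx trmx_mul linearZ /= trmxK -scalemxAr scalemxAl.
Qed.

Lemma reflection_mul z : z != 0 -> reflection z *m reflection z = 1%:M.
Proof.
move=> z0; apply/row_matrixP => i; rewrite row_mul row1.
set x := row i (reflection z); have -> : x = delta_mx 0 i *m reflection z by rewrite -rowE.
rewrite !mul_reflection dotDl dotNl dotZl; set e := delta_mx 0 i.
have zz : dot z z != 0 by rewrite dot_eq0.
rewrite -addrA -opprD -scalerDl; set k := (X in X *: z); have -> : k = 0 by rewrite /k; field.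
by rewrite scale0r subr0.
Qed.

Lemma rotation_mul_reflections y z : y != 0 -> z != 0 ->
  rotation_matrix (reflection y *m reflection z).
Proof.
move=> y0 z0; split.
  by rewrite trmx_mul !reflection_tr mulmxA -(mulmxA _ _ (reflection z)) reflection_mul //
     mulmx1 reflection_mul.
have det z' : z' != 0 -> \det (reflection z') = - 1.
  move=> z'0; rewrite det_rank1_update -scalemxAr mulmx_tr_dot !mxE eqxx mulr1n.
  by rewrite divfK ?dot_eq0 //; ring.
by rewrite det_mulmx !det // mulrNN mulr1.
Qed.

Lemma rotation_matrix_mul (A B : 'M[R]_n) :
  rotation_matrix A -> rotation_matrix B -> rotation_matrix (A *m B).
Proof.
move=> [A1 A2] [B1 B2]; split; last by rewrite det_mulmx A2 B2 mulr1.
by rewrite trmx_mul mulmxA -(mulmxA _ B) B1 mulmx1.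
Qed.

(** Reflecting in x and then in x + y sends x to -x and then to y, and two reflections make a
    rotation. The case y = -x needs a detour, for which a second coordinate must exist. *)
Lemma rotation_transitive x y : (2 <= n)%N -> dot x x = dot y y ->
  exists2 B, rotation_matrix B & x *m B = y.
Proof.
move=> n2 xy.
have gen x' y' : x' != 0 -> x' + y' != 0 -> dot x' x' = dot y' y' ->
    exists2 B, rotation_matrix B & x' *m B = y'.
  move=> x'0 s0 xy'; exists (reflection x' *m reflection (x' + y')).
    exact: rotation_mul_reflections.
  have xx : dot x' x' != 0 by rewrite dot_eq0.
  have ss : dot (x' + y') (x' + y') != 0 by rewrite dot_eq0.
  rewrite mulmxA (mul_reflection x' x') mulfK // -[X in X - _]scale1r -scalerBl.
  have -> : 1 - 2 = - 1 :> R by ring.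
  rewrite scaleN1r mulNmx mul_reflection.
  have E : 2 * dot x' (x' + y') = dot (x' + y') (x' + y').
    by rewrite !(dotDl, dotDr) (dotC y' x') -xy'; ring.
  by rewrite E mulfV // scale1r opprB addrC addKr.
have [x0|x0] := eqVneq x 0.
  have y0 : y = 0 by apply/eqP; rewrite -dot_eq0 -xy x0 dot_eq0.
  exists 1%:M; first by split; rewrite ?trmx1 ?mul1mx ?det1.
  by rewrite x0 y0 mul0mx.
have [s0|s0] := eqVneq (x + y) 0; last exact: gen.
have {s0}yE : y = - x by apply/eqP; rewrite -addr_eq0 addrC s0.
have [i xi] := row_neq0P x0; have [j ji] := other_index n2 i.
pose w := x - (2 * x 0 i) *: delta_mx 0 i.
have dd' (k : 'I_n) u : dot (delta_mx 0 k) u = u 0 k by rewrite dotC dot_delta.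
have dw : dot w w = dot x x.
  by rewrite /w !(dotDl, dotDr, dotNl, dotNr, dotZl, dotZr) !dot_delta !dd' !mxE !eqxx /=; ring.
have wj : w 0 j = x 0 j by rewrite !mxE eqxx (negbTE ji) mulr0 subr0.
have wi : w 0 i = - x 0 i by rewrite !mxE !eqxx mulr1; ring.
(* [x] and [-x] are linked through a third vector, not opposite to either. *)
have [m [mm m1 m2]] : exists m, [/\ dot m m = dot x x, x + m != 0 & m - x != 0].
  (* If the [j]-th entry is vacant, the [i]-th one is moved there; otherwise the sign of the [i]-th
     entry is flipped. *)
  have [xj|xj] := eqVneq (x 0 j) 0.
    exists (x 0 i *: delta_mx 0 j + (x - x 0 i *: delta_mx 0 i)); split.
    - rewrite !(dotDl, dotDr, dotNl, dotNr, dotZl, dotZr).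
      by rewrite !dot_delta !dd' !mxE !eqxx (negbTE ji) (eq_sym i) (negbTE ji) xj /=; ring.
    - apply/eqP => /matrixP/(_ 0 j); rewrite !mxE !eqxx (negbTE ji) xj mulr0 mulr1 subr0 !addr0 add0r.
      by apply/eqP.
    - apply/eqP => /matrixP/(_ 0 j); rewrite !mxE !eqxx (negbTE ji) xj mulr0 mulr1 !subr0 !addr0.
      by apply/eqP.
  exists w; split => //; apply/eqP => /matrixP.
    by move/(_ 0 j); rewrite mxE wj mxE => /eqP; rewrite -mulr2n mulrn_eq0 (negbTE xj).
  by move/(_ 0 i); rewrite mxE wi !mxE => /eqP; rewrite -opprD oppr_eq0 -mulr2n mulrn_eq0 (negbTE xi).
have m0 : m != 0 by rewrite -dot_eq0 mm dot_eq0.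
have [B1 rB1 E1] := gen x m x0 m1 (esym mm).
have [|B2 rB2 E2] := gen m y m0 _ (etrans mm xy); first by rewrite yE.
by exists (B1 *m B2); [exact: rotation_matrix_mul|rewrite mulmxA E1].
Qed.

End LinearAlgebra.

(** * Directional derivatives *)

Section Calculus.
Variables (R : realType) (U W : normedModType R).
Implicit Types (u v w a b : U) (f : U -> W).

Lemma derivable_line f v b (s : R) : derivable f (v + s *: b) b ->
  is_derive s 1 (fun r : R => f (v + r *: b)) ('D_b f (v + s *: b)).
Proof.
have E : (fun h : R => h^-1 *: (f (v + (h *: (1 : R) + s) *: b) - f (v + s *: b))) =
         (fun h : R => h^-1 *: (f (h *: b + (v + s *: b)) - f (v + s *: b))).
  apply/funext => h; rewrite scalerDl [h *: (1 : R)]/GRing.scale /= mulr1.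
  by rewrite addrCA.
move=> fd; apply: DeriveDef; first by rewrite /derivable E.
by rewrite /derive E.
Qed.

Lemma deriveDZ f v u w (k : R) : differentiable f v ->
  'D_(k *: u + w) f v = k *: 'D_u f v + 'D_w f v.
Proof. by move=> fd; rewrite !deriveE // linearP. Qed.

Lemma derive_scale f v u (k : R) : differentiable f v ->
  'D_(k *: u) f v = k *: 'D_u f v.
Proof. by move=> fd; rewrite !deriveE // linearZ. Qed.

Lemma derive_vsum f v (I : finType) (k : I -> R) (u : I -> U) : differentiable f v ->
  'D_(\sum_i k i *: u i) f v = \sum_i k i *: 'D_(u i) f v.
Proof.
move=> fd; rewrite deriveE // linear_sum; apply: eq_bigr => i _.
by rewrite linearZ deriveE.
Qed.

Lemma differentiable_bound f v (e : R) : differentiable f v -> 0 < e ->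
  exists2 d : R, 0 < d & forall w, `|w| < d -> `|f (v + w) - f v - 'D_w f v| <= e * `|w|.
Proof.
move=> fd e0; have /eqaddoP/(_ _ e0)/nbhs_ballP[d /= d0 Hd] := diff_locally fd.
exists d => // w wd; have := Hd w; rewrite -ball_normE /= sub0r normrN => /(_ wd).
rewrite deriveE //; congr (_ <= _); congr (`| _ |).
by rewrite !fctE /= opprD addrA (addrC v).
Qed.

End Calculus.

Section LinearComposition.
Variables (R : realType) (U W W' : normedModType R).

Lemma linear_comp_derive (l : {linear W -> W'}) (K : R) (f : U -> W) (v u : U) :
  (forall x : W, `|l x| <= K * `|x|) -> differentiable f v ->
  differentiable (l \o f) v /\ 'D_u (l \o f) v = l ('D_u f v).
Proof.
move=> lK fd; have lc : continuous l.
  move=> a; apply/cvgrPdist_le => e e0.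
  have K0 : 0 < `|K| + 1 by rewrite ltr_wpDl.
  apply/nbhs_ballP; exists (e / (`|K| + 1)) => /=; first by rewrite divr_gt0.
  move=> b; rewrite -ball_normE /= ltr_pdivlMr // => ab.
  rewrite -linearB; apply: le_trans (lK _) _; apply: le_trans (ltW ab).
  rewrite mulrC ler_wpM2l //; have := ler_norm K; lra.
have ld : differentiable l (f v) by exact: linear_differentiable.
have lfd : differentiable (l \o f) v by exact: differentiable_comp.
by split => //; rewrite !deriveE // diff_comp // diff_lin.
Qed.

End LinearComposition.

(** * Symmetry of second derivatives *)

Section Schwarz.
Variables (R : realType) (U : normedModType R).
Implicit Types (u v w a b : U) (f : U -> R).

(** The mean value theorem is used once, in direction [b]; the two resulting values of [g] are then
    expanded at [v], so differentiability of [g] at that single point is enough. *)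
Let second_difference f g v a b (r : R) (d : R) :
  0 < r -> (forall w, `|w| < r -> derivable f (v + w) b /\ 'D_b f (v + w) = g (v + w)) ->
  differentiable g v -> 0 < d ->
  exists2 e : R, 0 < e & forall s : R, 0 < s -> s < e ->
    `|f (v + s *: a + s *: b) - f (v + s *: a) - f (v + s *: b) + f v
      - 'D_a g v * s ^+ 2| <= d * s ^+ 2.
Proof.
move=> r0 fd bd d0.
(* Chosen so that [s * N] bounds the sum of the lengths of the two displacements at which [g] is
   expanded. *)
pose N := `|a| + 2 * `|b| + 1.
have N0 : 0 < N by rewrite ltr_wpDl // addr_ge0 // mulr_ge0.
have [e e0 He] := differentiable_bound bd (divr_gt0 d0 N0).
pose m := Num.min e r / N.
have m0 : 0 < m by rewrite divr_gt0 // lt_min e0.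
exists m => // s s0; rewrite ltr_pdivlMr // lt_min => /andP[sNe sNr].
have bnd (c : R) : 0 <= c <= s -> `|s *: a + c *: b| <= s * N /\ `|c *: b| <= s * N /\
    `|s *: a + c *: b| + `|c *: b| <= s * N.
  move=> /andP[c0 cs].
  have h1 : `|c *: b| <= s * `|b| by rewrite normrZ ger0_norm // ler_wpM2r.
  have h2 : `|s *: a| = s * `|a| by rewrite normrZ gtr0_norm.
  have h3 := ler_normD (s *: a) (c *: b).
  have h4 := mulr_ge0 (ltW s0) (normr_ge0 a); have h5 := mulr_ge0 (ltW s0) (normr_ge0 b).
  by have := normr_ge0 (c *: b); rewrite /N !mulrDr mulr1 mulrCA => h6; repeat split; lra.
pose phi c := f (v + s *: a + c *: b) - f (v + c *: b).
pose dphi c := g (v + s *: a + c *: b) - g (v + c *: b).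
have phid c : 0 <= c <= s -> is_derive c 1 phi (dphi c).
  move=> /bnd[h1 [h2 _]].
  have d1 : is_derive c 1 (fun c => f (v + s *: a + c *: b)) (g (v + s *: a + c *: b)).
    have [] := fd _ (le_lt_trans h1 sNr); rewrite addrA => fb <-.
    exact: derivable_line.
  have d2 : is_derive c 1 (fun c => f (v + c *: b)) (g (v + c *: b)).
    have [fb <-] := fd _ (le_lt_trans h2 sNr); exact: derivable_line.
  exact: is_deriveB.
have [c cs E] := mean_value (ltW s0) phid.
have -> : f (v + s *: a + s *: b) - f (v + s *: a) - f (v + s *: b) + f v = dphi c * s.
  move: E; rewrite /phi scale0r !addr0 subr0 => <-.
  have aux (x y z w : R) : x - y - z + w = x - z - (y - w) by ring.
  exact: aux.
rewrite expr2 !mulrA -mulrBl normrM (gtr0_norm s0) ler_wpM2r ?(ltW s0) //.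
have [h1 [h2 h3]] := bnd c cs.
have H1 := He _ (le_lt_trans h1 sNe); have H2 := He _ (le_lt_trans h2 sNe).
have D1 : 'D_(s *: a + c *: b) g v = s * 'D_a g v + c * 'D_b g v.
  by rewrite deriveDZ // derive_scale.
have D2 : 'D_(c *: b) g v = c * 'D_b g v by rewrite derive_scale.
rewrite D1 in H1; rewrite D2 in H2.
have -> : dphi c - 'D_a g v * s =
  (g (v + (s *: a + c *: b)) - g v - (s * 'D_a g v + c * 'D_b g v))
  - (g (v + c *: b) - g v - c * 'D_b g v).
  rewrite addrA /dphi.
  have aux (p q z x y : R) : p - q - x * s = (p - z - (s * x + c * y)) - (q - z - c * y).
    by ring.
  exact: aux.
apply: le_trans (ler_normB _ _) _; apply: le_trans (lerD H1 H2) _.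
rewrite -mulrDr mulrAC ler_pdivrMr // -mulrA ler_wpM2l ?(ltW d0) //.
Qed.

Let close_coefficients (x p q d r : R) : 0 < r -> `|x - p * r| <= d / 2 * r ->
  `|x - q * r| <= d / 2 * r -> `|p - q| <= d.
Proof.
move=> r0 h1 h2; rewrite -(ler_pM2r r0) -{1}(gtr0_norm r0) -normrM.
have -> : (p - q) * r = (x - q * r) - (x - p * r) by ring.
by apply: le_trans (ler_normB _ _) _; lra.
Qed.

(** The second difference is symmetric in [a] and [b], and divided by s^2 it tends to either mixed
    derivative. *)
Lemma derive_comm f ga gb v a b (r : R) : 0 < r ->
  (forall w, `|w| < r -> derivable f (v + w) a /\ 'D_a f (v + w) = ga (v + w)) ->
  (forall w, `|w| < r -> derivable f (v + w) b /\ 'D_b f (v + w) = gb (v + w)) ->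
  differentiable ga v -> differentiable gb v ->
  'D_a gb v = 'D_b ga v.
Proof.
move=> r0 fa fb ad bd; apply/eqP; rewrite -subr_eq0 -normr_le0; apply/ler_addgt0Pr => d d0.
rewrite add0r; have d2 : 0 < d / 2 by rewrite divr_gt0.
have [e1 e10 H1] := @second_difference f gb v a b r _ r0 fb bd d2.
have [e2 e20 H2] := @second_difference f ga v b a r _ r0 fa ad d2.
pose s := Num.min e1 e2 / 2.
have m0 : 0 < Num.min e1 e2 by rewrite lt_min e10.
have s0 : 0 < s by rewrite divr_gt0.
have [m1 m2] : Num.min e1 e2 <= e1 /\ Num.min e1 e2 <= e2 by rewrite !ge_min !lexx orbT.
have se1 : s < e1 by rewrite /s; lra.
have se2 : s < e2 by rewrite /s; lra.
have {}H1 := H1 s s0 se1; have {}H2 := H2 s s0 se2.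
have s20 : 0 < s ^+ 2 by rewrite exprn_gt0.
apply: (close_coefficients s20) H1 _; move: H2; congr (`| _ - _ | <= _).
have aux (x y z w : R) : x - y - z + w = x - z - y + w by ring.
by rewrite (addrAC v) aux.
Qed.

End Schwarz.

(** * Covectors and curves in an immersed set *)

Section Tangency.
Variables (R : realType) (U W : normedModType R).

(* A covector that vanishes on the image of the derivative of an immersion also
   kills the velocity of every curve lying in the immersed set: the curve lifts
   with [|c - v| = O(|s|)] because the derivative is bounded below. *)
Lemma covector_curve (X : U -> W) (v : U) (C K : R) (l : {linear W -> R})
    (g : R -> W) (xi : W) :
  differentiable X v -> (forall u, `|u| <= C * `|'D_u X v|) ->
  (forall a : W, `|l a| <= K * `|a|) -> (forall u, l ('D_u X v) = 0) ->
  is_derive (0 : R) 1 g xi -> g 0 = X v ->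
  (forall d : R, 0 < d -> exists2 r : R, 0 < r & forall s : R, `|s| < r ->
     exists2 c, `|c - v| < d & X c = g s) ->
  l xi = 0.
Proof.
move=> Xd XC lK lX gd g0 lift.
have gdiff : differentiable g (0 : R) by apply/derivable1_diffP; case: gd.
have gD (s : R) : 'D_s g 0 = s *: xi.
  have -> : s = s *: (1 : R) by rewrite /GRing.scale /= mulr1.
  by rewrite derive_scale //; have [_ ->] := gd; rewrite [s *: (1 : R)]/GRing.scale /= mulr1.
pose C' := `|C| + 1; pose K' := `|K| + 1.
have C'0 : 0 < C' by rewrite ltr_wpDl.
have K'0 : 0 < K' by rewrite ltr_wpDl.
have {}XC u : `|u| <= C' * `|'D_u X v|.
  by apply: le_trans (XC u) _; rewrite ler_wpM2r // /C'; have := ler_norm C; lra.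
have {}lK (a : W) : `|l a| <= K' * `|a|.
  by apply: le_trans (lK a) _; rewrite ler_wpM2r // /K'; have := ler_norm K; lra.
pose B := K' * (2 * C' * (`|xi| + 1) + 1).
have B0 : 0 < B by rewrite mulr_gt0 // ltr_wpDl // !mulr_ge0 ?addr_ge0 // ltW.
apply/eqP; rewrite -normr_le0; apply/ler_addgt0Pr => e e0; rewrite add0r.
(* The bound 1 / (2 C') lets the error [e1 * |w|] be absorbed into |w|, the bound 1 controls the
   chord of [g], and e / B makes the final estimate at most [e]. *)
pose e1 := Num.min (e / B) (Num.min 1 (1 / (2 * C'))).
have e10 : 0 < e1.
  rewrite !lt_min; apply/and3P; split; [exact: divr_gt0|exact: ltr01|].
  by apply: divr_gt0 => //; apply: mulr_gt0.
have [e1B e11 e1C] : [/\ e1 * B <= e, e1 <= 1 & e1 * C' <= 1 / 2].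
  split; rewrite ?ge_min ?lexx ?orbT //.
    by rewrite -ler_pdivlMr // ge_min lexx.
  have -> : 1 / 2 = 1 / (2 * C') * C' by field; rewrite gt_eqF.
  by rewrite ler_wpM2r ?(ltW C'0) // !ge_min lexx !orbT.
have [d d0 Hd] := differentiable_bound Xd e10.
have [r r0 Hr] := lift d d0.
have [q q0 Hq] := differentiable_bound gdiff e10.
pose s := Num.min r q / 2.
have m0 : 0 < Num.min r q by rewrite lt_min r0.
have s0 : 0 < s by rewrite divr_gt0.
have [m1 m2] : Num.min r q <= r /\ Num.min r q <= q by rewrite !ge_min !lexx orbT.
have sr : `|s| < r by rewrite gtr0_norm // /s; lra.
have sq : `|s| < q by rewrite gtr0_norm // /s; lra.
have [c cd Xc] := Hr s sr.
have := Hd _ cd; rewrite (addrC v) subrK Xc => H1.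
have := Hq _ sq; rewrite add0r gD g0 => H2.
set w := c - v in cd H1.
rewrite (gtr0_norm s0) in H2.
have n1 : `|g s - X v| <= s * (`|xi| + 1).
  rewrite -(subrK (s *: xi) (g s - X v)); apply: le_trans (ler_normD _ _) _.
  rewrite normrZ (gtr0_norm s0); apply: le_trans (lerD H2 (lexx _)) _.
  have := ler_wpM2r (ltW s0) e11; lra.
have n2 : `|w| <= 2 * C' * (s * (`|xi| + 1)).
  have h1 := XC w.
  have h2 : `|'D_w X v| <= `|g s - X v| + e1 * `|w|.
    have -> : 'D_w X v = (g s - X v) - (g s - X v - 'D_w X v) by rewrite opprB addrC subrK.
    by apply: le_trans (ler_normB _ _) _; rewrite lerD2l.
  have h3 := ler_wpM2l (ltW C'0) (le_trans h2 (lerD n1 (lexx (e1 * `|w|)))).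
  have h4 := ler_wpM2r (normr_ge0 w) e1C; lra.
have n3 : `|l (g s - X v)| <= K' * (e1 * `|w|).
  have -> : l (g s - X v) = l (g s - X v - 'D_w X v) by rewrite [in RHS]linearB lX subr0.
  by apply: le_trans (lK _) _; rewrite ler_wpM2l // ltW.
have n4 : s * `|l xi| <= `|l (g s - X v)| + K' * (e1 * s).
  rewrite -{1}(gtr0_norm s0) -normrM.
  have -> : s * l xi = l (g s - X v) - l (g s - X v - s *: xi).
    have -> : l (g s - X v - s *: xi) = l (g s - X v) - s * l xi by rewrite linearB linearZ.
    by rewrite subKr.
  apply: le_trans (ler_normB _ _) _; rewrite lerD2l.
  by apply: le_trans (lK _) _; rewrite ler_wpM2l // ltW.
have n5 : s * `|l xi| <= s * (e1 * B).
  apply: le_trans n4 _; apply: le_trans (lerD n3 (lexx _)) _.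
  have := ler_wpM2l (ltW (mulr_gt0 K'0 e10)) n2; rewrite /B; lra.
by move: n5; rewrite ler_pM2l // => /le_trans; apply.
Qed.

End Tangency.

(** * The ambient space *)

Section AmbientSpace.
Variables (R : realType) (n : nat).
Implicit Types (p x y : 'rV[R]_(n + 1)) (q a b w : ambient R n).

Lemma mx_norm_entry m k (A : 'M[R]_(m, k)) i j : `|A i j| <= `|A|.
Proof.
rewrite [leRHS]/Num.Def.normr /= mx_normrE.
exact: (le_bigmax _ (fun ij => `|A ij.1 ij.2|) (i, j)).
Qed.

Lemma mx_norm_le m k (A : 'M[R]_(m, k)) (c : R) : 0 <= c ->
  (forall i j, `|A i j| <= c) -> `|A| <= c.
Proof.
move=> c0 Ac; rewrite [leLHS]/Num.Def.normr /= mx_normrE.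
by apply: bigmax_le => // -[i j] _; exact: Ac.
Qed.

Lemma norm_fst_le w : `|w.1| <= `|w|.
Proof. by rewrite prod_normE le_max lexx. Qed.

Lemma norm_snd_le w : `|w.2| <= `|w|.
Proof. by rewrite prod_normE le_max lexx orbT. Qed.

Lemma mulmx_bound m k (B : 'M[R]_(m, k)) : exists2 K, 0 <= K &
  forall y : 'rV[R]_m, `|y *m B| <= K * `|y|.
Proof.
pose K := \sum_i \sum_j `|B i j|.
have K0 : 0 <= K by apply: sumr_ge0 => i _; apply: sumr_ge0.
exists K => // y; apply: mx_norm_le => [|i j]; first exact: mulr_ge0.
rewrite mxE; apply: le_trans (ler_norm_sum _ _ _) _.
rewrite mulr_suml; apply: ler_sum => l _.
rewrite normrM mulrC; apply: ler_pM => //; last exact: mx_norm_entry.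
by rewrite (bigD1 j) //= lerDl sumr_ge0.
Qed.

Definition crd (i : 'I_n) w : R := lsubmx w.1 0 i.
Definition hgt w : R := height w.1.
Definition tim w : R := w.2.

Fact crd_is_linear i : linear (crd i).
Proof. by move=> k a b; rewrite /crd !mxE. Qed.
HB.instance Definition _ i :=
  GRing.isLinear.Build R (ambient R n) R _ (crd i) (crd_is_linear i).

Fact hgt_is_linear : linear hgt.
Proof. by move=> k a b; rewrite /hgt /height !mxE. Qed.
HB.instance Definition _ := GRing.isLinear.Build R (ambient R n) R _ hgt hgt_is_linear.

Fact tim_is_linear : linear tim.
Proof. by []. Qed.
HB.instance Definition _ := GRing.isLinear.Build R (ambient R n) R _ tim tim_is_linear.

Lemma crd_bound i w : `|crd i w| <= 1 * `|w|.
Proof.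
by rewrite mul1r /crd mxE; apply: le_trans (norm_fst_le w); exact: mx_norm_entry.
Qed.

Lemma hgt_bound w : `|hgt w| <= 1 * `|w|.
Proof.
by rewrite mul1r /hgt /height mxE; apply: le_trans (norm_fst_le w); exact: mx_norm_entry.
Qed.

Lemma tim_bound w : `|tim w| <= 1 * `|w|.
Proof. by rewrite mul1r; exact: norm_snd_le. Qed.

(** The height is left out: a tangent vector at a point of positive height recovers it from Lorentz
    orthogonality to the position, so these functionals give all covectors on the tangent space. *)
Definition covector (a : 'rV[R]_n) (b : R) w : R := dot a (lsubmx w.1) + b * w.2.

Lemma dot_sum_crd (a : 'rV[R]_n) w : dot a (lsubmx w.1) = \sum_i a 0 i * crd i w.
Proof. by []. Qed.

Fact covector_is_linear (a : 'rV[R]_n) (b : R) : linear (covector a b).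
Proof.
move=> k u w; rewrite /covector /= linearD linearZ /= dotDr dotZr.
by rewrite scalerDr /GRing.scale /=; ring.
Qed.
HB.instance Definition _ (a : 'rV[R]_n) (b : R) :=
  GRing.isLinear.Build R (ambient R n) R _ (covector a b) (covector_is_linear a b).

Lemma covector_bound (a : 'rV[R]_n) (b : R) w : `|covector a b w| <= (\sum_i `|a 0 i| + `|b|) * `|w|.
Proof.
apply: le_trans (ler_normD _ _) _; rewrite mulrDl; apply: lerD.
  rewrite dot_sum_crd; apply: le_trans (ler_norm_sum _ _ _) _.
  rewrite mulr_suml; apply: ler_sum => i _; rewrite normrM ler_wpM2l //.
  by have := crd_bound i w; rewrite mul1r.
by rewrite normrM ler_wpM2l // norm_snd_le.
Qed.

Fact rotate_is_linear (B : 'M[R]_n) : linear (@rotate R n B).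
Proof.
move=> k u w; rewrite /rotate /=; congr pair.
by rewrite !linearP /= mulmxDl -scalemxAl scale_row_mx add_row_mx.
Qed.
HB.instance Definition _ B :=
  GRing.isLinear.Build R (ambient R n) (ambient R n) _ (@rotate R n B) (rotate_is_linear B).

Lemma rotate_bound (B : 'M[R]_n) : exists K : R, forall w, `|rotate B w| <= K * `|w|.
Proof.
have [K K0 BK] := mulmx_bound B; exists (K + 1) => w.
have w0 := normr_ge0 w.
have Kw : 0 <= K * `|w| by exact: mulr_ge0.
rewrite mulrDl mul1r {1}prod_normE ge_max; apply/andP; split => /=; last first.
  by apply: le_trans (norm_snd_le w) _; rewrite lerDr.
apply: mx_norm_le => [|i j]; first exact: addr_ge0.
rewrite mxE; case: splitP => k _.
  apply: le_trans (mx_norm_entry _ _ _) _; apply: le_trans (BK _) _.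
  rewrite -[leLHS]addr0 lerD // ler_wpM2l //; apply: le_trans (norm_fst_le w).
  by apply: mx_norm_le => // i' j'; rewrite mxE mx_norm_entry.
rewrite mxE; apply: le_trans (mx_norm_entry _ _ _) _.
by apply: le_trans (norm_fst_le w) _; rewrite lerDr.
Qed.

Lemma lorentzE x y : lorentz x y = dot (lsubmx x) (lsubmx y) - height x * height y.
Proof. by []. Qed.

Lemma heightD x y : height (x + y) = height x + height y.
Proof. by rewrite /height !mxE. Qed.

Lemma heightZ (k : R) x : height (k *: x) = k * height x.
Proof. by rewrite /height !mxE. Qed.

Lemma lorentzC x y : lorentz x y = lorentz y x.
Proof. by rewrite !lorentzE dotC mulrC. Qed.

Lemma lorentzDl x y p : lorentz (x + y) p = lorentz x p + lorentz y p.
Proof. by rewrite !lorentzE linearD dotDl heightD; ring. Qed.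

Lemma lorentzZl (k : R) x p : lorentz (k *: x) p = k * lorentz x p.
Proof. by rewrite !lorentzE linearZ /= dotZl heightZ; ring. Qed.

Lemma metricE a b : metric a b = lorentz a.1 b.1 - a.2 * b.2.
Proof. by []. Qed.

Lemma metricC a b : metric a b = metric b a.
Proof. by rewrite !metricE lorentzC mulrC. Qed.

Lemma metricDl a b w : metric (a + b) w = metric a w + metric b w.
Proof. by rewrite !metricE /= lorentzDl; ring. Qed.

Lemma metricZl (k : R) a w : metric (k *: a) w = k * metric a w.
Proof. by rewrite !metricE /= lorentzZl /GRing.scale /=; ring. Qed.

Lemma metric_suml (I : finType) (F : I -> ambient R n) w :
  metric (\sum_i F i) w = \sum_i metric (F i) w.
Proof.
have m0 : metric 0 w = 0 by rewrite -(scale0r 0) metricZl mul0r.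
exact: (big_morph (fun a => metric a w) (fun a b => metricDl a b w) m0).
Qed.

Lemma ambient_eq a b : lsubmx a.1 = lsubmx b.1 -> hgt a = hgt b -> tim a = tim b -> a = b.
Proof.
case: a b => [a1 a2] [b1 b2] /= e1 e2 e3; congr pair; last exact: e3.
rewrite -[a1]hsubmxK -[b1]hsubmxK e1; congr row_mx.
by apply/matrixP => i j; rewrite !ord1; exact: e2.
Qed.

Lemma lorentz_derive (U : normedModType R) (f g : U -> ambient R n) (v u : U) :
  differentiable f v -> differentiable g v ->
  is_derive v u (fun z => lorentz (f z).1 (g z).1)
    (lorentz ('D_u f v).1 (g v).1 + lorentz (f v).1 ('D_u g v).1).
Proof.
move=> fd gd.
have comp (l : {linear ambient R n -> R}) (k : U -> ambient R n) :
    (forall a : ambient R n, `|l a| <= 1 * `|a|) -> differentiable k v ->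
    is_derive v u (l \o k) (l ('D_u k v)).
  move=> lb kd; have [d e] := linear_comp_derive u lb kd.
  by apply: DeriveDef => //; exact: diff_derivable.
have cf i := comp (crd i) f (crd_bound i) fd.
have cg i := comp (crd i) g (crd_bound i) gd.
have dS := is_derive_sum (fun i => is_deriveM (cf i) (cg i)).
have dh := is_deriveM (comp hgt f hgt_bound fd) (comp hgt g hgt_bound gd).
have dSB := is_deriveB dS dh.
have -> : (fun z => lorentz (f z).1 (g z).1) =
    (\sum_(i < n) (crd i \o f) * (crd i \o g)) - (hgt \o f) * (hgt \o g).
  by apply/funext => z; rewrite [RHS]/= !fctE fct_sumE.
apply: is_derive_eq; rewrite !lorentzE /GRing.scale /=.
move: ('D_u f v) ('D_u g v) (f v) (g v) => Df Dg p q.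
have -> : dot (lsubmx Df.1) (lsubmx q.1) = \sum_i crd i q * crd i Df.
  by apply: eq_bigr => i _; rewrite mulrC.
rewrite big_split /= -!dot_sum_crd -!/(hgt _); ring.
Qed.

End AmbientSpace.

(** * Parametrized hypersurfaces *)

Section Parametrization.
Variables (R : realType) (n : nat) (M : set (ambient R n)).
Variables (V : set 'rV[R]_n) (X : 'rV[R]_n -> ambient R n).
Hypothesis M_hyp : M `<=` @hyperbolicXR R n.
Hypothesis X_param : local_parametrization M V X.
Implicit Types (u v w : 'rV[R]_n).

Lemma param_ball v : V v -> exists2 r : R, 0 < r & forall w, `|w - v| < r -> V w.
Proof.
have [Vo _ _ _ _] := X_param => Vv.
have /nbhs_ballP[r /= r0 Hr] : nbhs v V by exact: open_nbhs_nbhs.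
by exists r => // w wr; apply: Hr; rewrite -ball_normE /= distrC.
Qed.

Lemma param_near v : V v -> \near v, V v.
Proof. by have [Vo _ _ _ _] := X_param => Vv; exact: open_nbhs_nbhs. Qed.

Lemma param_differentiable v : V v -> differentiable X v.
Proof. by have [_ /(_ 1%N)[H _] _ _ _] := X_param; exact: H. Qed.

Lemma param_differentiable2 u v : V v -> differentiable ('D_u X) v.
Proof. by have [_ /(_ 2%N)[_ /(_ u)[H _]] _ _ _] := X_param; exact: H. Qed.

Lemma param_mem v : V v -> M (X v).
Proof.
have [Vo _ _ _ /(_ V Vo (@subset_refl _ V))[U _ E]] := X_param => Vv.
by have : (X @` V) (X v) by [exists v]; rewrite E => -[].
Qed.

Lemma param_lorentz v : V v -> lorentz (X v).1 (X v).1 = -1.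
Proof. by move=> /param_mem/M_hyp[]. Qed.

Lemma param_height v : V v -> 0 < hgt (X v).
Proof. by move=> /param_mem/M_hyp[]. Qed.

Lemma param_tangent v u : V v -> lorentz (X v).1 ('D_u X v).1 = 0.
Proof.
move=> Vv; have Xd := param_differentiable Vv.
have := lorentz_derive u Xd Xd => -[_ E].
have E0 : 'D_u (fun z => lorentz (X z).1 (X z).1) v = 'D_u (cst (-1 : R)) v.
  by apply: near_eq_derive; apply: filterS (param_near Vv) => z; exact: param_lorentz.
by move: E; rewrite E0 derive_cst lorentzC; lra.
Qed.

(** Differentiated tangency. It trades the component of a second derivative along the position
    vector for first derivatives. *)
Lemma param_tangent2 v u w : V v ->
  lorentz ('D_w X v).1 ('D_u X v).1 + lorentz (X v).1 ('D_w ('D_u X) v).1 = 0.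
Proof.
move=> Vv; have Xd := param_differentiable Vv; have X2 := param_differentiable2 u Vv.
have := lorentz_derive w Xd X2 => -[_ <-].
rewrite -(derive_cst (0 : R) v w); apply: near_eq_derive.
by apply: filterS (param_near Vv) => z; exact: param_tangent.
Qed.

Lemma param_dot v : V v ->
  dot (lsubmx (X v).1) (lsubmx (X v).1) = hgt (X v) ^+ 2 - 1.
Proof. by move=> /param_lorentz; rewrite lorentzE -/(hgt _) expr2; lra. Qed.

Lemma param_dot_tangent v u : V v ->
  dot (lsubmx (X v).1) (lsubmx ('D_u X v).1) = hgt (X v) * hgt ('D_u X v).
Proof. by move=> /(param_tangent u); rewrite lorentzE -/(hgt _) -/(hgt _); lra. Qed.

Lemma metric_tangent v u w : metric ('D_u X v) ('D_w X v) =
  dot (lsubmx ('D_u X v).1) (lsubmx ('D_w X v).1) - hgt ('D_u X v) * hgt ('D_w X v)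
  - tim ('D_u X v) * tim ('D_w X v).
Proof. by []. Qed.

Lemma derive_basis v u : V v ->
  'D_u X v = \sum_(i < n) u 0 i *: 'D_(delta_mx 0 i) X v.
Proof.
by move=> /param_differentiable Xd; rewrite {1}(row_sum_delta u) derive_vsum.
Qed.

(** After the height is dropped, the derivative of the immersion is an n by n + 1 matrix of rank n:
    its row space is the kernel of one covector, and its pseudo-inverse supplies the constant
    [C]. *)
Lemma param_normal_covector v : V v -> exists a b,
  [/\ a != 0 \/ b != 0,
      forall w s, dot a w + b * s = 0 <->
        exists u, lsubmx ('D_u X v).1 = w /\ tim ('D_u X v) = s &
      exists C : R, forall u, `|u| <= C * `|'D_u X v|].
Proof.
move=> Vv; have Xd := param_differentiable Vv.
pose flat (q : ambient R n) : 'rV[R]_(n + 1) := row_mx (lsubmx q.1) (q.2)%:M.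
have flat_lin : linear flat.
  move=> k p q; rewrite /flat /= linearP scale_row_mx add_row_mx; congr row_mx.
  by apply/matrixP => i j; rewrite !ord1 !mxE !eqxx !mulr1n.
pose N : 'M[R]_(n, n + 1) := \matrix_(i < n) flat ('D_(delta_mx 0 i) X v).
have flatN u : flat ('D_u X v) = u *m N.
  rewrite derive_basis // mulmx_sum_row.
  pose fl : {linear ambient R n -> 'rV[R]_(n + 1)} :=
    HB.pack flat (GRing.isLinear.Build _ _ _ _ flat flat_lin).
  rewrite -[flat]/(fl : _ -> _) linear_sum; apply: eq_bigr => i _.
  by rewrite linearZ rowK.
have Nfree : row_free N.
  apply: inj_row_free => u; rewrite -flatN -row_mx0 => /eq_row_mx[e1 e2].
  have [_ _ Xi _ _] := X_param; apply: (Xi v Vv).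
  have e3 : tim ('D_u X v) = 0.
    by move/matrixP/(_ 0 0): e2; rewrite !mxE eqxx mulr1n.
  apply: ambient_eq; rewrite ?e1 ?e3 ?linear0 //.
  have := param_dot_tangent u Vv; rewrite e1 -(scale0r 0) dotZr mul0r.
  by move/esym/eqP; rewrite mulf_eq0 gt_eqF ?param_height //= => /eqP ->.
have [c c0 cN] := hyperplane_of_row_free Nfree.
pose a := (usubmx c)^T; pose b := dsubmx c 0 0.
have cE w (s : R) : row_mx w s%:M *m c = (dot a w + b * s)%:M.
  rewrite -[c in LHS]vsubmxK mul_row_col mul_scalar_mx.
  rewrite -[usubmx c]trmxK mulmx_tr_dot -/a dotC raddfD /=; congr (_ + _).
  by apply/matrixP => i j; rewrite !ord1 [LHS]mxE [RHS]mxE eqxx mulr1n mulrC.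
exists a, b; split.
- have [a0|] := eqVneq a 0; last by left.
  right; apply: contra c0 => /eqP b0; rewrite -[c]vsubmxK -[usubmx c]trmxK -/a a0 trmx0.
  have -> : dsubmx c = 0 by apply/matrixP => i j; rewrite !ord1 [RHS]mxE -b0.
  by rewrite col_mx0.
- move=> w s; have -> : dot a w + b * s = 0 <-> row_mx w s%:M *m c = 0.
    rewrite cE; split=> [->|]; first by rewrite raddf0.
    by move/matrixP/(_ 0 0); rewrite !mxE eqxx mulr1n.
  rewrite cN; split=> -[u].
    rewrite -flatN => /eq_row_mx[e1 e2]; exists u; split => //.
    by move/matrixP/(_ 0 0): e2; rewrite !mxE eqxx !mulr1n.
  by move=> [<- <-]; exists u; rewrite -flatN.
- have [K K0 HK] := mulmx_bound (pinvmx N); exists K => u.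
  have {1}-> : u = flat ('D_u X v) *m pinvmx N by rewrite flatN mulmxKp.
  apply: le_trans (HK _) _; rewrite ler_wpM2l //.
  apply: mx_norm_le => // i j; rewrite mxE; case: splitP => k _.
    have := crd_bound k ('D_u X v); rewrite mul1r /crd ord1; apply.
  by rewrite !ord1 mxE eqxx mulr1n norm_snd_le.
Qed.

(** The homeomorphism clause, applied to small balls about [v], provides the lifts close to [v] that
    [covector_curve] requires. *)
Lemma param_curve_covector v a b (g : R -> ambient R n) xi : V v ->
  (forall u, dot a (lsubmx ('D_u X v).1) + b * tim ('D_u X v) = 0) ->
  is_derive (0 : R) 1 g xi -> g 0 = X v -> (\forall s \near (0 : R), M (g s)) ->
  dot a (lsubmx xi.1) + b * xi.2 = 0.
Proof.
move=> Vv ab gd g0 gM.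
have [_ [_ [_ _ [C HC]]]] := param_normal_covector Vv.
apply: (@covector_curve _ _ _ X v C _ (covector a b) g xi) => //.
- exact: param_differentiable.
- exact: covector_bound.
move=> d d0; have [Vo _ _ _ Xh] := X_param.
have Bo : open (V `&` ball v d) by apply: openI => //; exact: ball_open.
have [U Uo E] := Xh _ Bo (@subIsetl _ _ _).
have Ug : U (g 0).
  have : (X @` (V `&` ball v d)) (X v) by exists v => //; split => //; exact: ballxx.
  by rewrite E -g0 => -[].
have gc : {for (0 : R), continuous g}.
  by case: gd => /derivable1_diffP/differentiable_continuous.
have gU : \forall s \near (0 : R), U (g s) by apply: gc; exact: open_nbhs_nbhs.
have : \forall s \near (0 : R), (M `&` U) (g s) by near=> s; split; near: s.
rewrite -E => /nbhs_ballP[r /= r0 Hr]; exists r => // s sr.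
have [|c [Vc cd] cs] := Hr s; first by rewrite /ball /= sub0r normrN.
by exists c => //; move: cd; rewrite -ball_normE /= distrC.
Unshelve. all: by end_near. Qed.

End Parametrization.

(** * Time-like directions and rotated curves *)

Section Profile.
Variables (R : realType) (n : nat) (M : set (ambient R n)).
Variables (V : set 'rV[R]_n) (X : 'rV[R]_n -> ambient R n).
Hypothesis n_ge2 : (2 <= n)%N.
Hypothesis M_hyp : M `<=` @hyperbolicXR R n.
Hypothesis M_rot : rotationally_invariant M.
Hypothesis X_param : local_parametrization M V X.
Implicit Types (u v w x : 'rV[R]_n).

Lemma gram_row_col v (p q : 'rV[R]_n) : V v ->
  (p *m gram X v *m q^T) 0 0 = metric ('D_p X v) ('D_q X v).
Proof.
move=> Vv; rewrite (derive_basis X_param p Vv) metric_suml mxE.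
under eq_bigr do rewrite mxE mulr_suml.
rewrite exchange_big /=; apply: eq_bigr => i _.
rewrite metricZl metricC (derive_basis X_param q Vv) metric_suml mulr_sumr.
by apply: eq_bigr => j _; rewrite metricZl metricC !mxE; ring.
Qed.

Lemma timelike_direction v : V v -> lorentzian_gram (gram X v) ->
  exists u, metric ('D_u X v) ('D_u X v) < 0.
Proof.
move=> Vv [P _ E].
have n1 : (n.-1 < n)%N by rewrite prednK // (leq_trans _ n_ge2).
(* The entry -1 of [minkowski_mx] sits at the last index. *)
pose i := Ordinal n1; exists (row i P); rewrite -gram_row_col //.
have -> : (row i P *m gram X v *m (row i P)^T) 0 0 = (P *m gram X v *m P^T) i i.
  rewrite -row_mul [LHS]mxE [RHS]mxE; apply: eq_bigr => j _.
  by congr (_ * _); [rewrite mxE|rewrite !mxE].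
by rewrite E !mxE eqxx /= prednK ?eqxx ?(leq_trans _ n_ge2) // mulr1n; lra.
Qed.

Lemma is_derive_scalel (k : R -> R) (l t : R) (a : ambient R n) :
  is_derive t 1 k l -> is_derive t 1 (fun s => k s *: a) (l *: a).
Proof.
move=> [kd kE]; have kdiff : differentiable k t by exact/derivable1_diffP.
have d : differentiable (fun s => k s *: a) t by exact: differentiableZl.
by apply: DeriveDef; [exact/derivable1_diffP|rewrite deriveE // diffZl // -kE deriveE].
Qed.

Definition horizontal (x : 'rV[R]_n) : ambient R n := (row_mx x 0, 0).

(** A rational curve of rotations, which avoids trigonometric functions: the two reflections cancel
    at s = 0, and the velocity there is twice the infinitesimal rotation of the (i, j) plane. *)
Lemma rotation_velocity (q : ambient R n) (i j : 'I_n) : i != j ->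
  let x := lsubmx q.1 in
  let B (s : R) := reflection (delta_mx 0 i) *m reflection (delta_mx 0 i + s *: delta_mx 0 j) in
  [/\ forall s, rotation_matrix (B s), rotate (B 0) q = q &
      is_derive (0 : R) 1 (fun s => rotate (B s) q)
        (2 * x 0 i *: horizontal (delta_mx 0 j) - 2 * x 0 j *: horizontal (delta_mx 0 i))].
Proof.
move=> ij x B.
have dd (k l : 'I_n) : dot (delta_mx 0 k : 'rV[R]_n) (delta_mx 0 l) = (k == l)%:R.
  by rewrite dot_delta mxE eqxx /= eq_sym.
have zz (s : R) : dot (delta_mx 0 i + s *: delta_mx 0 j) (delta_mx 0 i + s *: delta_mx 0 j) = 1 + s ^+ 2.
  rewrite !(dotDl, dotDr, dotZl, dotZr) !dd !eqxx (negbTE ij) (eq_sym j) (negbTE ij).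
  by rewrite !mulr0 add0r addr0 mulr1 expr2.
have zp (s : R) : 0 < 1 + s ^+ 2 by rewrite ltr_wpDr // sqr_ge0.
pose y := x - (2 * x 0 i) *: delta_mx 0 i.
have yi : y 0 i = - x 0 i.
  suff H (z : 'rV[R]_n) : (z - (2 * z 0 i) *: delta_mx 0 i) 0 i = - z 0 i by exact: H.
  by rewrite !mxE !eqxx /=; ring.
have yj : y 0 j = x 0 j.
  suff H (z : 'rV[R]_n) : (z - (2 * z 0 i) *: delta_mx 0 i) 0 j = z 0 j by exact: H.
  by rewrite !mxE (eq_sym j) (negbTE ij) andbF mulr0 subr0.
pose k (s : R) := 2 * (s * x 0 j - x 0 i) / (1 + s ^+ 2).
pose q0 : ambient R n := (row_mx y (rsubmx q.1), q.2).
have BE s : rotate (B s) q =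
    q0 - (k s *: horizontal (delta_mx 0 i) + (k s * s) *: horizontal (delta_mx 0 j)).
  rewrite /rotate /B mulmxA -/x (mul_reflection x) dd eqxx divr1 dot_delta -/y mul_reflection zz.
  rewrite /q0 /horizontal; congr pair; last by rewrite /= !scaler0 addr0 subr0.
  rewrite /= !scale_row_mx !scaler0 add_row_mx addr0 opp_row_mx add_row_mx subr0; congr row_mx.
  rewrite dotDr dotZr !dot_delta yi yj -(scalerA (k s)) -scalerDr.
  by congr (_ - _ *: _); rewrite /k; congr (_ / _); ring.
have k0 : k 0 = - (2 * x 0 i) by rewrite /k expr0n /= addr0 divr1; ring.
split.
- move=> s; apply: rotation_mul_reflections.
    by rewrite -dot_eq0 dd eqxx oner_eq0.
  by rewrite -dot_eq0 zz gt_eqF.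
- rewrite BE k0 mulr0 scale0r addr0 /q0 /horizontal scaleNr opprK [RHS]surjective_pairing.
  congr pair; last by rewrite /= scaler0 addr0.
  by rewrite /= scale_row_mx scaler0 add_row_mx addr0 /y subrK hsubmxK.
- have kd : is_derive (0 : R) 1 k (2 * x 0 j).
    have d2 : is_derive (0 : R) 1 (fun s : R => 1 + s ^+ 2) 0.
      by apply: is_derive_eq; rewrite /GRing.scale /=; ring.
    have d3 := @is_deriveV _ (fun s : R => 1 + s ^+ 2) 0 0 1 (lt0r_neq0 (zp 0)) d2.
    rewrite /k; apply: is_derive_eq.
    by rewrite /GRing.scale /= !mulr0 expr0n /= !add0r subr0 addr0 invr1 mul1r mulr1.
  have ksd : is_derive (0 : R) 1 (fun s => k s * s) (- (2 * x 0 i)).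
    by apply: is_derive_eq; rewrite /GRing.scale /= k0; ring.
  have d1 := is_derive_scalel (horizontal (delta_mx 0 i)) kd.
  have d2 := is_derive_scalel (horizontal (delta_mx 0 j)) ksd.
  have := is_deriveB (is_derive_cst q0 (0 : R) 1) (is_deriveD d1 d2).
  congr is_derive; first by apply/funext => s; rewrite BE.
  by rewrite scaleNr sub0r opprD opprK addrC.
Qed.

(* Rotating the curve [s |-> X (v + s u)] about an axis point rotates its
   velocity, so the tangent hyperplane there is rotation invariant. *)
Lemma axis_rotation_velocity v u (B : 'M[R]_n) : V v -> rotation_matrix B ->
  lsubmx (X v).1 = 0 ->
  [/\ is_derive (0 : R) 1 (fun s : R => rotate B (X (v + s *: u))) (rotate B ('D_u X v)),
       rotate B (X (v + (0 : R) *: u)) = X v &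
       \forall s \near (0 : R), M (rotate B (X (v + s *: u)))].
Proof.
move=> Vv rB x0; split.
- have [K HK] := rotate_bound B.
  have Xd := param_differentiable X_param Vv.
  have [d e] := linear_comp_derive u HK Xd.
  have E : v = v + (0 : R) *: u by rewrite scale0r addr0.
  have : is_derive (0 : R) 1 (fun s : R => (rotate B \o X) (v + s *: u))
      ('D_u (rotate B \o X) (v + (0 : R) *: u)).
    by apply: derivable_line; rewrite -E; exact: diff_derivable.
  by rewrite -E e.
- rewrite scale0r addr0 /rotate x0 mul0mx; case: (X v) x0 => p t /= p0.
  by rewrite -[p in RHS]hsubmxK p0.
- have [r r0 Hr] := param_ball X_param Vv.
  have nu : 0 < `|u| + 1 by rewrite ltr_wpDl.
  apply/nbhs_ballP; exists (r / (`|u| + 1)) => /=; first exact: divr_gt0.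
  move=> s; rewrite /ball /= sub0r normrN ltr_pdivlMr // => sr.
  apply: M_rot => //; apply: (param_mem X_param); apply: Hr.
  rewrite addrC addKr normrZ; apply: le_lt_trans sr.
  by rewrite ler_wpM2l // lerDl.
Qed.

End Profile.

(** * The slope of the profile curve *)

Section ProfileSlope.
Variables (R : realType) (n : nat) (M : set (ambient R n)).
Variables (V : set 'rV[R]_n) (X : 'rV[R]_n -> ambient R n).
Hypothesis n_ge2 : (2 <= n)%N.
Hypothesis M_hyp : M `<=` @hyperbolicXR R n.
Hypothesis M_rot : rotationally_invariant M.
Hypothesis X_param : local_parametrization M V X.
Implicit Types (u v w x : 'rV[R]_n).

(** Slices of constant t are space-like: with s = 0, the Cauchy-Schwarz bound would force eta = 0
    and then ww < 0. *)
Let timelike_time (h eta s ww : R) : 0 <= h ^+ 2 - 1 -> (h * eta) ^+ 2 <= (h ^+ 2 - 1) * ww ->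
  0 <= ww -> ww - eta * eta - s * s < 0 -> s != 0.
Proof.
move=> h1 cs ww0 tl; apply/eqP => s0; move: tl; rewrite s0 mulr0 subr0 subr_lt0 => tl.
have := ler_wpM2l h1 (ltW tl); have : 0 <= eta * eta by rewrite -expr2 sqr_ge0.
by move: cs; rewrite exprMn -!expr2; nra.
Qed.

(** The two inequalities combine to h^2 lam^2 s^2 < (h^2 - 1)(lam^2 + 1) s^2, from which s^2
    cancels. *)
Let timelike_slope (h lam s ww : R) : 0 < h ^+ 2 - 1 -> s != 0 ->
  (h * (lam * s)) ^+ 2 <= (h ^+ 2 - 1) * ww -> ww - (lam * s) * (lam * s) - s * s < 0 ->
  lam ^+ 2 < h ^+ 2 - 1.
Proof.
move=> h1 s0 cs; rewrite -addrA -opprD subr_lt0 => tl.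
have s2 : 0 < s ^+ 2 by rewrite lt_neqAle sqr_ge0 eq_sym sqrf_eq0 s0.
have := ltr_pM2l h1; move=> /(_ ww (lam * s * (lam * s) + s * s)); rewrite tl => /idP H.
by rewrite -(ltr_pM2r s2); have := le_lt_trans cs H; lra.
Qed.

Lemma covector_horizontal (a x : 'rV[R]_n) (b : R) : covector a b (horizontal x) = dot a x.
Proof. by rewrite /covector /horizontal /= row_mxKl mulr0 addr0. Qed.

(** The direction [uf] is the velocity of the profile curve: radial in the hyperbolic factor and
    normalized by dt = 1. *)
Lemma param_profile v : V v -> lorentzian_gram (gram X v) ->
  exists lam uf, [/\ 1 < hgt (X v), forall u, hgt ('D_u X v) = lam * tim ('D_u X v),
    lam ^+ 2 < hgt (X v) ^+ 2 - 1 &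
    [/\ lsubmx ('D_uf X v).1 = (lam * hgt (X v) / (hgt (X v) ^+ 2 - 1)) *: lsubmx (X v).1,
        hgt ('D_uf X v) = lam & tim ('D_uf X v) = 1]].
Proof.
move=> Vv lg; set x := lsubmx (X v).1; set h := hgt (X v).
have h0 : 0 < h := param_height M_hyp X_param Vv.
have xx : dot x x = h ^+ 2 - 1 := param_dot M_hyp X_param Vv.
have h1 : 0 <= h ^+ 2 - 1 by rewrite -xx dot_ge0.
have xw u : dot x (lsubmx ('D_u X v).1) = h * hgt ('D_u X v).
  exact: (param_dot_tangent M_hyp X_param u Vv).
have cs u : (h * hgt ('D_u X v)) ^+ 2 <=
    (h ^+ 2 - 1) * dot (lsubmx ('D_u X v).1) (lsubmx ('D_u X v).1).
  by rewrite -xw -xx dot_cauchy_schwarz.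
have [a [b [ab0 abE _]]] := param_normal_covector M_hyp X_param Vv.
have abu u : dot a (lsubmx ('D_u X v).1) + b * tim ('D_u X v) = 0.
  by apply/abE; exists u.
have curve g xi := @param_curve_covector _ _ _ _ _ M_hyp X_param v a b g xi Vv abu.
have [u0 u0t] := timelike_direction n_ge2 X_param Vv lg.
rewrite metric_tangent in u0t.
have s0 : tim ('D_u0 X v) != 0.
  exact: (timelike_time h1 (cs u0) (dot_ge0 _) u0t).
have a0 : a != 0.
  apply/eqP => a0; case: ab0 => [|b0]; first by rewrite a0 eqxx.
  have := abu u0; rewrite a0 /dot big1 ?add0r => [|i _]; last by rewrite mxE mul0r.
  by move/eqP; rewrite mulf_eq0 (negbTE b0) (negbTE s0).
(* The normal covector kills the velocities of all rotations, so its spatial part is parallel to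
   [x]. *)
have a_x i j : a 0 j * x 0 i = a 0 i * x 0 j.
  have [->//|ij] := eqVneq i j.
  have [rB B0 Bd] := rotation_velocity (X v) ij.
  have BM : \forall s \near (0 : R), M (rotate (reflection (delta_mx 0 i) *m
      reflection (delta_mx 0 i + s *: delta_mx 0 j)) (X v)).
    by apply: (@filterE _ (nbhs (0 : R))) => s; apply: M_rot; [exact: rB|exact: (param_mem X_param Vv)].
  have := curve _ _ Bd B0 BM.
  rewrite -/(covector a b _) linearB !linearZ /= !covector_horizontal !dot_delta -/x.
  by rewrite /GRing.scale /= => H; lra.
have x0 : x != 0.
  (* On the axis, [w1] is orthogonal to [a], hence the spatial part of a tangent vector with dt = 0;
     a rotation takes it to [w2], which must be tangent too although its product with [a] is a_i^2 +
     a_j^2 > 0. *)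
  apply/eqP => x0; have [i ai] := row_neq0P a0; have [j ji] := other_index n_ge2 i.
  pose w1 := a 0 i *: delta_mx 0 j - a 0 j *: delta_mx 0 i : 'rV[R]_n.
  pose w2 := a 0 i *: delta_mx 0 i + a 0 j *: delta_mx 0 j : 'rV[R]_n.
  have w12 : dot w1 w1 = dot w2 w2.
    rewrite /w1 /w2 !(dotDl, dotDr, dotNl, dotNr, dotZl, dotZr) !dot_delta !mxE.
    by rewrite !eqxx (negbTE ji) (eq_sym i) (negbTE ji) /=; ring.
  have [B rB BE] := rotation_transitive n_ge2 w12.
  have [|u [uw us]] := (abE w1 0).1.
    by rewrite mulr0 addr0 /w1 dotDr dotNr !dotZr !dot_delta; ring.
  have [Bd B0 BM] := axis_rotation_velocity M_rot X_param u Vv rB x0.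
  have := curve _ _ Bd B0 BM; rewrite /rotate /= row_mxKl uw BE -/(tim _) us mulr0 addr0.
  rewrite /w2 dotDr !dotZr !dot_delta -!expr2 => /eqP.
  by rewrite paddr_eq0 ?sqr_ge0 // sqrf_eq0 (negbTE ai).
have h1p : 0 < h ^+ 2 - 1 by rewrite -xx lt_neqAle dot_ge0 eq_sym dot_eq0 x0.
have h1gt : 1 < h.
  by rewrite subr_gt0 -(expr1n R 2) ltr_pXn2r ?nnegrE // ltW in h1p.
have [i xi] := row_neq0P x0; pose k := a 0 i / x 0 i.
have aE : a = k *: x.
  apply/rowP => j; rewrite mxE /k mulrAC -a_x mulrK ?unitfE //.
have k0 : k != 0 by apply: contra a0 => /eqP k0; rewrite aE k0 scale0r.
(* With a = k x and x . w = h dh(w), the normal covector reads k h dh + b dt. *)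
pose lam := - b / (k * h).
have lamE u : hgt ('D_u X v) = lam * tim ('D_u X v).
  have := abu u; rewrite aE dotZl xw /lam; move: (hgt _) (tim _) => eta s H.
  have kh : k * h != 0 by rewrite mulf_neq0 // gt_eqF.
  apply: (mulfI kh); rewrite [RHS]mulrA [X in _ = X * s]mulrC divfK //; lra.
have [|uf [ufw uft]] := (abE ((lam * h / (h ^+ 2 - 1)) *: x) 1).1.
  rewrite aE dotZl dotZr xx /lam; field.
  by rewrite k0 !gt_eqF.
exists lam, uf; split => //.
- by have := cs u0; rewrite lamE => H; apply: (timelike_slope h1p s0 H); rewrite -lamE.
- by split => //; rewrite lamE uft mulr1.
Qed.

End ProfileSlope.

(** * The mean curvature equation *)

Section Curvature.
Variables (R : realType) (n : nat) (M : set (ambient R n)).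
Variables (V : set 'rV[R]_n) (X : 'rV[R]_n -> ambient R n).
Hypothesis n_ge2 : (2 <= n)%N.
Hypothesis M_rot : rotationally_invariant M.
Hypothesis M_time : timelike M.
Hypothesis M_trans : translator M.
Hypothesis X_param : local_parametrization M V X.
Implicit Types (u v w x : 'rV[R]_n).

Let M_hyp : M `<=` @hyperbolicXR R n. Proof. by case: M_trans => -[]. Qed.

(** The factor lam, written as a quotient in a fixed direction so that its differentiability near
    [v] is evident; its value does not depend on [u0] as long as dt(u0) is nonzero. *)
Definition profile_slope u0 v : R := hgt ('D_u0 X v) / tim ('D_u0 X v).

Lemma functional_derive (l : {linear ambient R n -> R}) v u :
  (forall a : ambient R n, `|l a| <= 1 * `|a|) -> V v ->
  derivable (l \o X) v u /\ 'D_u (l \o X) v = l ('D_u X v).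
Proof.
move=> lb Vv; have [d e] := linear_comp_derive u lb (param_differentiable X_param Vv).
by split => //; exact: diff_derivable.
Qed.

Lemma functional_derive2 (l : {linear ambient R n -> R}) v u w :
  (forall a : ambient R n, `|l a| <= 1 * `|a|) -> V v ->
  differentiable (l \o 'D_u X) v /\ 'D_w (l \o 'D_u X) v = l ('D_w ('D_u X) v).
Proof.
by move=> lb Vv; exact: (linear_comp_derive w lb (param_differentiable2 X_param u Vv)).
Qed.

Lemma functional_derive_comm (l : {linear ambient R n -> R}) v u w :
  (forall a : ambient R n, `|l a| <= 1 * `|a|) -> V v ->
  l ('D_u ('D_w X) v) = l ('D_w ('D_u X) v).
Proof.
move=> lb Vv; have [r r0 Hr] := param_ball X_param Vv.
have [d1 e1] := functional_derive2 w u lb Vv.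
have [d2 e2] := functional_derive2 u w lb Vv.
apply: (etrans (esym e1)); apply: (etrans _ e2).
have H y z : `|z| < r -> derivable (l \o X) (v + z) y /\
    'D_y (l \o X) (v + z) = (l \o 'D_y X) (v + z).
  by move=> zr; apply: functional_derive => //; apply: Hr; rewrite addrC addKr.
exact: (derive_comm r0 (H u) (H w) d2 d1).
Qed.

Lemma profile_slopeE u0 v : V v -> tim ('D_u0 X v) != 0 ->
  exists uf, [/\ 1 < hgt (X v),
    forall u, hgt ('D_u X v) = profile_slope u0 v * tim ('D_u X v),
    profile_slope u0 v ^+ 2 < hgt (X v) ^+ 2 - 1 &
    [/\ lsubmx ('D_uf X v).1 = (profile_slope u0 v * hgt (X v) / (hgt (X v) ^+ 2 - 1))
          *: lsubmx (X v).1,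
        hgt ('D_uf X v) = profile_slope u0 v & tim ('D_uf X v) = 1]].
Proof.
move=> Vv t0; have lg := M_time X_param Vv.
have [lam [uf [h1 lamE lam2 uE]]] := param_profile n_ge2 M_hyp M_rot X_param Vv lg.
have -> : profile_slope u0 v = lam by rewrite /profile_slope lamE mulfK.
by exists uf.
Qed.

Lemma tim_near u0 v : V v -> tim ('D_u0 X v) != 0 ->
  \forall z \near v, V z /\ tim ('D_u0 X z) != 0.
Proof.
move=> Vv t0; have Vn := param_near X_param Vv.
have [d _] := functional_derive2 (l := @tim R n) u0 u0 (@tim_bound R n) Vv.
have c := differentiable_continuous d.
have tn : \forall z \near v, tim ('D_u0 X z) != 0.
  apply: (c [set y : R | y != 0]); apply: open_nbhs_nbhs; split => //; exact: open_neq.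
exact: filterI Vn tn.
Qed.

Lemma profile_slope_derivable u0 v u : V v -> tim ('D_u0 X v) != 0 ->
  derivable (profile_slope u0) v u.
Proof.
move=> Vv t0.
have [d1 _] := functional_derive2 (l := @tim R n) u0 u0 (@tim_bound R n) Vv.
have [d2 _] := functional_derive2 (l := @hgt R n) u0 u0 (@hgt_bound R n) Vv.
by apply: derivableM; [exact: diff_derivable|apply: derivableV => //; exact: diff_derivable].
Qed.

(** The relation dh(u) = lam dt(u) holds on a neighbourhood and is differentiated along [w] by the
    product rule. *)
Lemma profile_slope_hessian u0 v u w : V v -> tim ('D_u0 X v) != 0 ->
  hgt ('D_w ('D_u X) v) - profile_slope u0 v * tim ('D_w ('D_u X) v) =
  'D_w (profile_slope u0) v * tim ('D_u X v).
Proof.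
move=> Vv t0.
have [d1 e1] := functional_derive2 (l := @tim R n) u w (@tim_bound R n) Vv.
have [d2 e2] := functional_derive2 (l := @hgt R n) u w (@hgt_bound R n) Vv.
have sd : derivable (profile_slope u0) v w by exact: profile_slope_derivable.
have : 'D_w (@hgt R n \o 'D_u X) v = 'D_w (profile_slope u0 * (@tim R n \o 'D_u X)) v.
  apply: near_eq_derive; apply: filterS (tim_near Vv t0) => z [Vz tz].
  by have [uf [_ H _ _]] := profile_slopeE Vz tz; rewrite /= H.
have td : derivable (@tim R n \o 'D_u X) v w by exact: diff_derivable.
rewrite (deriveM sd td) e1 e2 => ->; rewrite /GRing.scale /=.
by rewrite addrAC subrr add0r mulrC.
Qed.

(** Second derivatives are symmetric, so dlam(w) dt(u) = dlam(u) dt(w); [uf] has dt = 1. *)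
Lemma profile_slope_gradient u0 v uf u : V v -> tim ('D_u0 X v) != 0 ->
  tim ('D_uf X v) = 1 ->
  'D_u (profile_slope u0) v = 'D_uf (profile_slope u0) v * tim ('D_u X v).
Proof.
move=> Vv t0 t1; rewrite -profile_slope_hessian //.
rewrite (functional_derive_comm (l := @hgt R n) uf u (@hgt_bound R n) Vv).
rewrite (functional_derive_comm (l := @tim R n) uf u (@tim_bound R n) Vv).
by rewrite profile_slope_hessian // t1 mulr1.
Qed.

Let trans_gram v : V v -> gram X v \in unitmx.
Proof. by move=> Vv; have [_ nd _] := M_trans; exact: (nd _ _ X_param). Qed.

(* The covector dual to the normal [(h q - e_{n+1}, lam)], with e_{n+1} the last
   basis vector; it sees only the tangential part of a vector. *)
Definition normal_form (q : ambient R n) (lam : R) (a : ambient R n) : R :=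
  hgt q * lorentz a.1 q.1 + hgt a - lam * tim a.

Fact normal_form_is_linear q lam : linear (normal_form q lam).
Proof.
move=> k a b; rewrite /normal_form !linearD !linearZ /= lorentzDl lorentzZl /GRing.scale /=.
ring.
Qed.
HB.instance Definition _ q lam := GRing.isLinear.Build R (ambient R n) R _
  (normal_form q lam) (normal_form_is_linear q lam).

Lemma normal_form_tangent_part q lam a : lorentz q.1 q.1 = -1 ->
  normal_form q lam (tangent_part q a) = normal_form q lam a.
Proof.
move=> qq; rewrite /normal_form /tangent_part /= lorentzDl lorentzZl qq.
by rewrite /hgt /tim /= heightD heightZ (lorentzC q.1); ring.
Qed.

(** The position component of [D2] is minus the Lorentz product of [Di] and [Dj], and that product
    is the metric plus dt dt; hence the coefficient mu - h. *)
Lemma normal_form_hessian (q D2 Di Dj : ambient R n) (lam mu : R) : lorentz q.1 q.1 = -1 ->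
  hgt D2 - lam * tim D2 = mu * tim Di * tim Dj ->
  lorentz Di.1 Dj.1 + lorentz q.1 D2.1 = 0 ->
  normal_form q lam (tangent_part q D2) =
  - hgt q * metric Di Dj + (mu - hgt q) * (tim Di * tim Dj).
Proof.
move=> qq hE tE; rewrite normal_form_tangent_part // /normal_form -addrA hE metricE lorentzC.
have -> : lorentz q.1 D2.1 = - lorentz Di.1 Dj.1 by apply/eqP; rewrite -addr_eq0 addrC tE.
by rewrite /tim; ring.
Qed.

(** Metrically, the profile direction is dual to rho dt. As dt = 1 on it, the inverse metric gives
    dt the square 1 / rho. *)
Lemma metric_profile (q Df Dj : ambient R n) (lam : R) : 0 < hgt q ^+ 2 - 1 ->
  lsubmx Df.1 = (lam * hgt q / (hgt q ^+ 2 - 1)) *: lsubmx q.1 ->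
  hgt Df = lam -> tim Df = 1 ->
  dot (lsubmx q.1) (lsubmx Dj.1) = hgt q * hgt Dj -> hgt Dj = lam * tim Dj ->
  metric Df Dj = (lam ^+ 2 / (hgt q ^+ 2 - 1) - 1) * tim Dj.
Proof.
move=> qp fw fh ft qj jh; rewrite metricE lorentzE fw dotZl qj -!/(hgt _) -!/(tim _) fh ft jh.
by move: (hgt q) qp => h qp; field; rewrite gt_eqF.
Qed.

Let solve_mean_curvature (h lam mu k rho : R) : rho != 0 ->
  - h * k + (mu - h) * rho^-1 = - lam -> mu = h + rho * (h * k - lam).
Proof.
move=> rho0 E; have -> : h * k - lam = (mu - h) / rho by lra.
by rewrite mulrC divfK // addrC subrK.
Qed.

Lemma trace_invmx (G : 'M[R]_n) (c : 'rV[R]_n) (k l : R) : G \in unitmx -> G^T = G ->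
  \sum_(i < n) \sum_(j < n) invmx G i j * (k * G i j + l * (c 0 i * c 0 j)) =
  k * n%:R + l * (c *m invmx G *m c^T) 0 0.
Proof.
move=> Gu Gs; have Gij i j : G j i = G i j by rewrite -[in LHS]Gs mxE.
have iG : invmx G *m G = 1%:M by rewrite mulVmx.
move: (invmx G) iG => Gi iG.
transitivity (k * (\sum_i \sum_j Gi i j * G i j) + l * (\sum_i \sum_j Gi i j * (c 0 i * c 0 j))).
  rewrite !mulr_sumr -big_split; apply: eq_bigr => i _.
  rewrite /= !mulr_sumr -big_split; apply: eq_bigr => j _ /=; ring.
congr (_ * _ + _ * _).
  rewrite -(mxtrace1 R n) -iG; apply: eq_bigr => i _; rewrite mxE.
  by apply: eq_bigr => j _; rewrite Gij.
rewrite mxE exchange_big /=; apply: eq_bigr => j _; rewrite [c^T _ _]mxE mxE mulr_suml.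
by apply: eq_bigr => i _; ring.
Qed.

Lemma gram_sym v : (gram X v)^T = gram X v.
Proof.
by apply/matrixP => i j; rewrite [LHS]mxE [LHS]mxE [RHS]mxE; exact: metricC.
Qed.

Lemma profile_equation u0 v u : V v -> tim ('D_u0 X v) != 0 ->
  'D_u (profile_slope u0) v =
  (hgt (X v) + (profile_slope u0 v ^+ 2 / (hgt (X v) ^+ 2 - 1) - 1) *
     (hgt (X v) * n%:R - profile_slope u0 v)) * tim ('D_u X v).
Proof.
move=> Vv t0; have [uf [h1 lamE lam2 [ufw ufh uft]]] := profile_slopeE Vv t0.
rewrite (profile_slope_gradient u Vv t0 uft); congr (_ * _).
have hess w z := profile_slope_hessian w z Vv t0.
have grad w := profile_slope_gradient w Vv t0 uft.
move: (profile_slope u0 v) ('D_uf (profile_slope u0) v) lamE lam2 ufw ufh hess grad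
  => lam mu lamE lam2 ufw ufh hess grad.
have Gu := trans_gram Vv.
pose N := normal_form (X v) lam.
pose t : 'rV[R]_n := \row_i tim ('D_(delta_mx 0 i) X v).
have qq := param_lorentz M_hyp X_param Vv.
have N_tan w : N ('D_w X v) = 0.
  by rewrite /N /normal_form lorentzC (param_tangent M_hyp X_param w Vv) mulr0 add0r lamE subrr.
(* The projection subtracts only tangent vectors, which [N] kills, so both sides of the translator
   equation can be paired with [N] before projecting. *)
have N_normal a : N (normal_part X v a) = N a.
  rewrite /N /normal_part linearB linear_sum big1 ?subr0 // => i _.
  rewrite linear_sum big1 // => j _; rewrite linearZ /=.
  by rewrite -/(N _) /partial N_tan /GRing.scale /= mulr0.
have N_hess i j : N (levi_civita X i j v) =
    - hgt (X v) * gram X v i j + (mu - hgt (X v)) * (t 0 i * t 0 j).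
  have -> : gram X v i j = metric ('D_(delta_mx 0 i) X v) ('D_(delta_mx 0 j) X v).
    by rewrite mxE.
  have -> : t 0 i = tim ('D_(delta_mx 0 i) X v) by rewrite mxE.
  have -> : t 0 j = tim ('D_(delta_mx 0 j) X v) by rewrite mxE.
  apply: normal_form_hessian => //; last exact: (param_tangent2 M_hyp X_param (delta_mx 0 j) (delta_mx 0 i) Vv).
  by rewrite hess grad.
have [_ _ /(_ V X X_param v Vv) E] := M_trans.
have {E} := congr1 N E; rewrite N_normal.
have -> : N (@dt R n) = - lam.
  rewrite /N /normal_form /dt /hgt /tim /= mulr1.
  have -> : lorentz 0 (X v).1 = 0 by rewrite -(scale0r 0) lorentzZl mul0r.
  by rewrite /height !mxE mulr0 !add0r.
have -> : N (mean_curvature X v) = - hgt (X v) * n%:R +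
    (mu - hgt (X v)) * (t *m invmx (gram X v) *m t^T) 0 0.
  rewrite -trace_invmx ?gram_sym // /N /mean_curvature linear_sum; apply: eq_bigr => i _.
  rewrite linear_sum; apply: eq_bigr => j _; rewrite linearZ /=.
  by rewrite /second_fundamental_form -/(N _) N_normal N_hess.
pose rho := lam ^+ 2 / (hgt (X v) ^+ 2 - 1) - 1.
have hh : 0 < hgt (X v) ^+ 2 - 1 by apply: le_lt_trans lam2; exact: sqr_ge0.
have rho0 : rho != 0 by rewrite subr_eq0 lt_eqF // ltr_pdivrMr ?mul1r.
have uG : uf *m gram X v = rho *: t.
  apply/rowP => j; rewrite [RHS]mxE [t 0 j]mxE.
  have -> : (uf *m gram X v) 0 j = metric ('D_uf X v) ('D_(delta_mx 0 j) X v).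
    by rewrite -(gram_row_col X_param) // mulmx_tr_dot [RHS]mxE eqxx mulr1n dot_delta.
  apply: metric_profile => //.
  exact: (param_dot_tangent M_hyp X_param (delta_mx 0 j) Vv).
have -> : (t *m invmx (gram X v) *m t^T) 0 0 = rho^-1.
  have tG : t *m invmx (gram X v) = rho^-1 *: uf.
    by rewrite -[t]scale1r -(mulVf rho0) -scalerA -uG -scalemxAl mulmxK.
  rewrite tG -scalemxAl mxE.
  have -> : (uf *m t^T) 0 0 = tim ('D_uf X v).
    rewrite (derive_basis X_param uf Vv) linear_sum mxE; apply: eq_bigr => i _.
    by rewrite linearZ /= !mxE.
  by rewrite uft mulr1.
exact: solve_mean_curvature.
Qed.

End Curvature.

(** * Local normal form *)

Section Arcosh.
Variable R : realType.
Implicit Types h : R.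

Lemma sqr_sqrt_sub1 h : 1 < h -> Num.sqrt (h ^+ 2 - 1) ^+ 2 = h ^+ 2 - 1.
Proof. by move=> h1; rewrite sqr_sqrtr // subr_ge0 expr_ge1 // ltW // (lt_trans ltr01). Qed.

Lemma sqrt_sub1_gt0 h : 1 < h -> 0 < Num.sqrt (h ^+ 2 - 1).
Proof. by move=> h1; rewrite sqrtr_gt0 subr_gt0 expr_gt1 // ltW // (lt_trans ltr01). Qed.

Lemma expR_arcosh h : 1 <= h -> expR (arcosh h) = h + Num.sqrt (h ^+ 2 - 1).
Proof. by move=> h1; rewrite lnK // posrE ltr_pwDl ?sqrtr_ge0 // (lt_le_trans ltr01). Qed.

Lemma expR_opp_arcosh h : 1 <= h -> expR (- arcosh h) = h - Num.sqrt (h ^+ 2 - 1).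
Proof.
move=> h1; rewrite expRN expR_arcosh //.
have p : 0 < h + Num.sqrt (h ^+ 2 - 1) by rewrite ltr_pwDl ?sqrtr_ge0 // (lt_le_trans ltr01).
apply: (mulfI (lt0r_neq0 p)); rewrite mulfV ?lt0r_neq0 // mulrC -subr_sqr sqr_sqrtr; first by ring.
by rewrite subr_ge0 expr_ge1 // (le_trans ler01).
Qed.

Lemma cosh_arcosh h : 1 <= h -> (expR (arcosh h) + expR (- arcosh h)) / 2 = h.
Proof. by move=> h1; rewrite expR_arcosh // expR_opp_arcosh //; field. Qed.

Lemma arcosh_gt0 h : 1 < h -> 0 < arcosh h.
Proof. by move=> h1; rewrite ln_gt0 // ltr_wpDr // sqrtr_ge0. Qed.

Lemma coth_arcosh h : 1 < h -> coth (arcosh h) = h / Num.sqrt (h ^+ 2 - 1).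
Proof.
move=> h1; rewrite /coth expR_arcosh ?ltW // expR_opp_arcosh ?ltW //.
have := sqrt_sub1_gt0 h1; move: (Num.sqrt _) => s s0; field.
by rewrite gt_eqF //=; apply/eqP; lra.
Qed.

Lemma arcosh_derive h : 1 < h -> is_derive h 1 (@arcosh R) (Num.sqrt (h ^+ 2 - 1))^-1.
Proof.
move=> h1; have s0 := sqrt_sub1_gt0 h1.
have p : 0 < h ^+ 2 - 1 by rewrite subr_gt0 expr_gt1 // ltW // (lt_trans ltr01).
have d1 : is_derive h 1 (fun y : R => y ^+ 2 - 1) (2 * h).
  by apply: is_derive_eq; rewrite /GRing.scale /=; ring.
have d2 : is_derive h 1 (fun y => Num.sqrt (y ^+ 2 - 1)) (h / Num.sqrt (h ^+ 2 - 1)).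
  have d := @is_derive1_comp R Num.sqrt (fun y => y ^+ 2 - 1) h _ _ (is_derive1_sqrt p) d1.
  by apply: is_derive_eq; field; rewrite gt_eqF.
have d3 := is_deriveD (is_derive_id h (1 : R)) d2.
have q : 0 < h + Num.sqrt (h ^+ 2 - 1) by rewrite addr_gt0 // (lt_trans ltr01).
have d4 := @is_derive1_comp R (@ln R) (fun y => y + Num.sqrt (y ^+ 2 - 1)) h _ _ (is_derive1_ln q) d3.
rewrite /arcosh; apply: is_derive_eq.
move: (Num.sqrt _) s0 q => s s0 q; field.
by rewrite !gt_eqF // addrC.
Qed.

(** Passage from (h, lam) to (x, y): differentiating the square root in y adds - y^2 coth x, and
    coth x (1 - y^2) turns the coefficient n into n - 1. *)
Lemma height_flow n (H L k : R -> R) (s : R) : 1 < H s ->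
  is_derive s 1 H (L s * k s) ->
  is_derive s 1 L ((H s + (L s ^+ 2 / (H s ^+ 2 - 1) - 1) * (H s * n%:R - L s)) * k s) ->
  is_flow n (fun r => arcosh (H r)) (fun r => L r / Num.sqrt (H r ^+ 2 - 1)) k s.
Proof.
move=> h1 Hd Ld; have s0 := sqrt_sub1_gt0 h1; have s2 := sqr_sqrt_sub1 h1.
have p : 0 < H s ^+ 2 - 1 by rewrite -s2 exprn_gt0.
split; first exact: arcosh_gt0.
  have d := @is_derive1_comp R (@arcosh R) H s _ _ (arcosh_derive h1) Hd.
  by apply: is_derive_eq; rewrite mulrA (mulrC _ (L s)).
have d1 : is_derive s 1 (fun r => H r ^+ 2 - 1) (2 * H s * (L s * k s)).
  by apply: is_derive_eq; rewrite /GRing.scale /=; ring.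
have d2 := @is_derive1_comp R Num.sqrt (fun r => H r ^+ 2 - 1) s _ _ (is_derive1_sqrt p) d1.
have d3 := @is_deriveV _ (Num.sqrt \o (fun r => H r ^+ 2 - 1)) s _ _ (lt0r_neq0 s0) d2.
have := is_deriveM Ld d3; rewrite [X in is_derive _ _ X _ -> _](_ : _ =
  (fun r => L r / Num.sqrt (H r ^+ 2 - 1))) // => d4; apply: is_derive_eq.
rewrite /spindle_rhs coth_arcosh // /GRing.scale /=.
move: (Num.sqrt _) s0 s2 => q q0 q2.
rewrite -q2; move: (H s) (L s) (k s) q2 => h l m q2.
have qn : q != 0 by rewrite gt_eqF.
by field; exact: qn.
Qed.

End Arcosh.

(** * The hypersurface as a local graph over time *)

Section LocalNormalForm.
Variables (R : realType) (n : nat) (M : set (ambient R n)).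
Hypothesis n_ge2 : (2 <= n)%N.
Hypothesis M_rot : rotationally_invariant M.
Hypothesis M_time : timelike M.
Hypothesis M_trans : translator M.

Let M_hyp : M `<=` @hyperbolicXR R n. Proof. by case: M_trans => -[]. Qed.

Let parametrized q : M q -> exists V X v, [/\ local_parametrization M V X, V v & X v = q].
Proof.
by case: M_trans => -[_ H] _ _ /H[V [X [PX [v Vv Xv]]]]; exists V, X, v.
Qed.

Lemma ball_segment (v w : 'rV[R]_n) (r s : R) : `|w - v| < r -> 0 <= s <= 1 ->
  `|v + s *: (w - v) - v| < r.
Proof.
move=> wr /andP[s0 s1]; rewrite addrC addKr normrZ ger0_norm //.
by apply: le_lt_trans wr; rewrite ler_piMl.
Qed.

Lemma local_spindle q : M q -> exists t0 g0 J psi U,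
  [/\ 0 < g0, spindle_solution n t0 g0 J psi, J (tim q), open U &
   U q /\ forall q', M q' -> U q' -> J (tim q') /\ tau q'.1 = psi (tim q')].
Proof.
move=> Mq; have [V [X [v [PX Vv Xv]]]] := parametrized Mq.
have [lam [uf [h1 lamE lam2 [_ _ uft]]]] :=
  param_profile n_ge2 M_hyp M_rot PX Vv (M_time PX Vv).
have t0 : tim ('D_uf X v) != 0 by rewrite uft oner_eq0.
pose S w := Num.sqrt (hgt (X w) ^+ 2 - 1).
have S0 : 0 < S v := sqrt_sub1_gt0 h1.
have slE : profile_slope X uf v = lam by rewrite /profile_slope lamE mulfK.
have y1 : `|lam / S v| < 1.
  rewrite normf_div (gtr0_norm S0) ltr_pdivrMr // mul1r.
  rewrite -(ltr_pXn2r (n := 2)) ?nnegrE ?(ltW S0) //.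
  by rewrite real_normK ?num_real // /S sqr_sqrt_sub1.
have [tc [gc [J [psi [gc0 sol Jt psit psi't]]]]] :=
  spindle_exists n_ge2 (tim (X v)) (arcosh_gt0 h1) y1.
have [psiJ _ _ _] := (spindle_solutionP n tc gc J psi).1 sol.
have [Jo _ _] := psiJ.
have tX_cont : {for v, continuous (@tim R n \o X)}.
  apply: differentiable_continuous.
  exact: (linear_comp_derive v (@tim_bound R n) (param_differentiable PX Vv)).1.
have nJ : \forall z \near v, J (tim (X z)).
  by apply: (tX_cont J); exact: open_nbhs_nbhs.
have : nbhs v [set z | [/\ V z, tim ('D_uf X z) != 0 & J (tim (X z))]].
  by apply: filterS2 (tim_near PX Vv t0) nJ => z [].
move=> /nbhs_ballP[r /= r0 Hr].
have {}Hr z : `|z - v| < r -> [/\ V z, tim ('D_uf X z) != 0 & J (tim (X z))].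
  by move=> zr; apply: Hr; rewrite -ball_normE /= distrC.
(* Along the segment from [v] to [w], the pair (x, y) of the hypersurface and (psi, psi') evaluated
   at the time coordinate are flows with the same speed and the same start. *)
have match_on w : `|w - v| < r -> tau (X w).1 = psi (tim (X w)).
  move=> wr; pose d := w - v; pose z (s : R) := v + s *: d.
  have zr s : 0 <= s <= 1 -> [/\ V (z s), tim ('D_uf X (z s)) != 0 & J (tim (X (z s)))].
    by move=> s01; apply: Hr; exact: ball_segment.
  pose k (s : R) := tim ('D_d X (z s)).
  have lineX (l : {linear ambient R n -> R}) s : (forall a : ambient R n, `|l a| <= 1 * `|a|) ->
      V (z s) -> is_derive s 1 (fun s => l (X (z s))) (l ('D_d X (z s))).
    move=> lb Vz; have [ld <-] := functional_derive PX d lb Vz.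
    exact: (@derivable_line _ _ _ (l \o X)).
  have [|||e _] := @flow_unique R n (fun s => tau (X (z s)).1)
     (fun s => profile_slope X uf (z s) / S (z s)) (fun s => psi (tim (X (z s))))
     (fun s => derive1 psi (tim (X (z s)))) k 0 1.
  - move=> s s01; have {}s01 : 0 <= s <= 1.
      by move: s01; rewrite (min_l (@ler01 R)) (max_r (@ler01 R)).
    have [Vz tz Jz] := zr s s01.
    have [_ [zh zE _ _]] := profile_slopeE n_ge2 M_rot M_time M_trans PX Vz tz.
    split.
    + apply: (@height_flow R n (fun s => hgt (X (z s))) (fun s => profile_slope X uf (z s))) => //.
        by rewrite /k -zE; exact: (lineX (@hgt R n) s (@hgt_bound R n) Vz).
      rewrite /k -(profile_equation n_ge2 M_rot M_time M_trans PX d Vz tz).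
      by apply: derivable_line; exact: (profile_slope_derivable PX).
    + have dt := lineX (@tim R n) s (@tim_bound R n) Vz.
      have [psi0 psid psidd] := spindle_flow_is_flow psiJ Jz.
      rewrite /= !mulr1 in psid psidd.
      split => //.
        exact: (@is_derive1_comp R psi _ _ _ _ psid dt).
      exact: (@is_derive1_comp R (derive1 psi) _ _ _ _ psidd dt).
    + have [dd _] := functional_derive2 (l := @tim R n) PX d d (@tim_bound R n) Vz.
      have kd : is_derive s 1 k ('D_d (@tim R n \o 'D_d X) (z s)).
        by apply: (@derivable_line _ _ _ (@tim R n \o 'D_d X)); exact: diff_derivable.
      exact: (is_derive_continuous kd).
  - by rewrite /z scale0r addr0 psit.
  - by rewrite /z scale0r addr0 psi't slE.
  by move: e; rewrite /z scale1r /d addrC subrK.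
have [Vo _ _ _ Xh] := PX.
have Bo : open (V `&` ball v r) by apply: openI => //; exact: ball_open.
have [U Uo E] := Xh _ Bo (@subIsetl _ _ _).
exists tc, gc, J, psi, U; split => //; first by rewrite -Xv.
split.
  have : (X @` (V `&` ball v r)) (X v) by exists v => //; split => //; exact: ballxx.
  by rewrite E Xv => -[].
move=> q' Mq' Uq'; have : (M `&` U) q' by [].
rewrite -E => -[w [_ wr] <-].
have wr' : `|w - v| < r by move: wr; rewrite -ball_normE /= distrC.
by split; [have [] := Hr w wr'|exact: match_on].
Qed.

(** In the profile direction the time coordinate has derivative 1, so by the intermediate value
    theorem it covers an interval. *)
Lemma tim_open q (W : set (ambient R n)) : M q -> open W -> W q ->
  exists2 e : R, 0 < e & forall s : R, `|s - tim q| < e ->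
    exists q', [/\ M q', W q' & tim q' = s].
Proof.
move=> Mq Wo Wq; have [V [X [v [PX Vv Xv]]]] := parametrized Mq.
have [lam [uf [_ _ _ [_ _ uft]]]] := param_profile n_ge2 M_hyp M_rot PX Vv (M_time PX Vv).
have Xc := differentiable_continuous (param_differentiable PX Vv).
have nW : \forall z \near v, W (X z).
  by apply: (Xc W); apply: open_nbhs_nbhs; split => //; rewrite Xv.
have : nbhs v [set z | V z /\ W (X z)] by exact: filterI (param_near PX Vv) nW.
move=> /nbhs_ballP[r /= r0 Hr].
pose z (s : R) := v + s *: uf; pose T (s : R) := tim (X (z s)).
have Td s : V (z s) -> is_derive s 1 T (tim ('D_uf X (z s))).
  move=> Vz; have [ld <-] := functional_derive PX uf (@tim_bound R n) Vz.
  exact: (@derivable_line _ _ _ (@tim R n \o X)).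
have z0 : z 0 = v by rewrite /z scale0r addr0.
have T0d : is_derive (0 : R) 1 T 1 by have := Td 0; rewrite z0 uft; apply.
(* A remainder of at most half the increment still moves the time by b / 2 on either side. *)
have half : 0 < 1 / 2 :> R by [].
have [d d0 Hd] := (is_deriveP T 0 1).1 T0d _ half.
have nu : 0 < `|uf| + 1 by rewrite ltr_wpDl.
pose b := Num.min d (r / (`|uf| + 1)) / 2.
have m0 : 0 < Num.min d (r / (`|uf| + 1)) by rewrite lt_min d0 divr_gt0.
have b0 : 0 < b by rewrite divr_gt0.
have bm : b < Num.min d (r / (`|uf| + 1)) by rewrite /b; lra.
have inb s : - b <= s <= b -> V (z s) /\ W (X (z s)).
  move=> sb; apply: Hr; rewrite -ball_normE /= /z opprD addrA subrr sub0r normrN normrZ.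
  have sn : `|s| <= b by rewrite ler_norml.
  apply: (@le_lt_trans _ _ (b * (`|uf| + 1))).
    by apply: ler_pM => //; rewrite lerDl.
  by rewrite -ltr_pdivlMr //; move: bm; rewrite lt_min => /andP[].
have bd : b < d by move: bm; rewrite lt_min => /andP[].
have T0 : T 0 = tim q by rewrite /T z0 Xv.
have Tb : T 0 + b / 2 <= T b.
  have := Hd b; rewrite subr0 mul1r gtr0_norm // => /(_ bd).
  by rewrite ler_norml => /andP[]; lra.
have TNb : T (- b) <= T 0 - b / 2.
  have := Hd (- b); rewrite subr0 mul1r normrN gtr0_norm // => /(_ bd).
  by rewrite ler_norml => /andP[_]; lra.
exists (b / 2); first exact: divr_gt0.
move=> s; rewrite ltr_norml -T0 => sb.
have Nbb : - b <= b by lra.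
have [||c] := @IVT R T (- b) b s Nbb.
- apply: continuous_in_subspaceT => x; rewrite inE /= in_itv /= => /inb[Vz _].
  exact: is_derive_continuous (Td x Vz).
- by rewrite min_l ?max_r; lra.
rewrite in_itv /= => /inb[Vz Wz] Tc; exists (X (z c)); split => //.
exact: (param_mem PX).
Qed.

End LocalNormalForm.

(** * Continuation along the hypersurface *)

Section Global.
Variables (R : realType) (n : nat) (M : set (ambient R n)).
Hypothesis n_ge2 : (2 <= n)%N.
Hypothesis M_connected : connected M.
Hypothesis M_rot : rotationally_invariant M.
Hypothesis M_time : timelike M.
Hypothesis M_trans : translator M.

Let M_hyp : M `<=` @hyperbolicXR R n. Proof. by case: M_trans => -[]. Qed.

Definition on_graph (J : set R) (g : R -> R) (q : ambient R n) : Prop :=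
  J (tim q) /\ tau q.1 = g (tim q).

Lemma tau_inj (p q : 'rV[R]_(n + 1)) : hyperbolic p -> hyperbolic q -> tau p = tau q ->
  height p = height q.
Proof.
have ge1 (x : 'rV[R]_(n + 1)) : hyperbolic x -> 1 <= height x.
  move=> [xx x0]; move: xx; rewrite lorentzE => xx.
  have := dot_ge0 (lsubmx x) => d0.
  by rewrite -(expr_ge1 (n := 2)) ?(ltW x0) // expr2; lra.
move=> /ge1 p1 /ge1 q1 e; rewrite -(cosh_arcosh p1) -(cosh_arcosh q1).
by move: e; rewrite /tau => ->.
Qed.

(** Gluing [h] onto [g] keeps the data at [t0], so maximality forbids the domain to grow. *)
Lemma maximal_absorbs t0 g0 J (g : R -> R) K (h : R -> R) s :
  maximal_spindle_solution n t0 g0 J g -> spindle_flow n K h -> J s -> K s ->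
  (\near s, g s = h s) -> K `<=` J /\ forall t, K t -> g t = h t.
Proof.
move=> [sol maxi] hK Js Ks gh.
have [gJ Jt0 gt0 g't0] := (spindle_solutionP n t0 g0 J g).1 sol.
have agree t : J t -> K t -> g t = h t.
  move=> Jt Kt; apply: (spindle_flow_unique gJ hK Js Ks Jt Kt _ _).1.
    exact: (nbhs_singleton gh).
  exact: near_eq_derive1.
have [|f [fJK fg fh]] := spindle_flow_union gJ hK _ agree; first by exists s.
have Jo : open J by case: gJ.
have fgn : \near t0, f t0 = g t0 by apply: filterS fg _; exact: open_nbhs_nbhs.
have E := maxi (J `|` K) f.
have KJ : J `|` K = J.
  apply: (E _ _ fg); last exact: subsetUl.
  apply/spindle_solutionP; split => //; [by left|by rewrite fg|].
  by rewrite (near_eq_derive1 fgn).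
have sub : K `<=` J by rewrite -KJ; exact: subsetUr.
by split => // t Kt; apply: agree => //; exact: sub.
Qed.

Lemma translator_on_maximal_graph q0 : M q0 -> exists t0 g0 J g,
  [/\ 0 < g0, maximal_spindle_solution n t0 g0 J g & forall q, M q -> on_graph J g q].
Proof.
move=> Mq0; have [t0 [g0 [J0 [psi [U0 [g00 sol0 _ U0o [U0q MU0]]]]]]] :=
  local_spindle n_ge2 M_rot M_time M_trans Mq0.
have [J [g [maxi J0J gpsi]]] := spindle_maximal sol0.
exists t0, g0, J, g; split => //.
pose good U := open U /\ forall q, M q -> U q -> on_graph J g q.
pose A := [set q | M q /\ exists2 U, good U & U q].
suff AM : A = M by move=> q; rewrite -AM => -[Mq [U [_ HU] Uq]]; exact: HU.
apply: M_connected.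
- exists q0; split => //; exists U0 => //; split => // q Mq Uq.
  by have [Jq e] := MU0 q Mq Uq; split; [exact: J0J|rewrite e (gpsi _ Jq).1].
- exists (\bigcup_(U in [set U | good U]) U).
    by apply: bigcup_open => U [].
  rewrite eqEsubset; split=> q.
    by move=> [Mq [U gU Uq]]; split => //; exists U.
  by move=> [Mq [U gU Uq]]; split => //; exists U.
- exists (closure A); first exact: closed_closure.
  rewrite eqEsubset; split=> q [Mq Aq]; split => //; first exact: subset_closure.
  have [t1 [g1 [K [h [U [_ solK Kq Uo [Uq MU]]]]]]] :=
    local_spindle n_ge2 M_rot M_time M_trans Mq.
  have [hK _ _ _] := (spindle_solutionP n t1 g1 K h).1 solK.
  have [q1 [[Mq1 [U1 [U1o HU1] U1q1]] Uq1]] := Aq U (open_nbhs_nbhs (conj Uo Uq)).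
  have UU1 : open (U `&` U1) by exact: openI.
  (* One common point would match values only. Points of the hypersurface at all nearby times make
     both solutions agree on an interval, hence also in their derivatives. *)
  have [e e0 He] := tim_open n_ge2 M_rot M_time M_trans Mq1 UU1 (conj Uq1 U1q1).
  have gh : \forall s \near tim q1, g s = h s.
    apply/nbhs_ballP; exists e => //= s; rewrite /ball /= distrC => /He[q2 [Mq2 [Uq2 U1q2] <-]].
    by have [_ <-] := HU1 q2 Mq2 U1q2; have [_ ->] := MU q2 Mq2 Uq2.
  have [KJ ghK] := maximal_absorbs maxi hK (HU1 q1 Mq1 U1q1).1 (MU q1 Mq1 Uq1).1 gh.
  exists U => //; split => // q2 Mq2 Uq2; have [Kq2 e2] := MU q2 Mq2 Uq2.
  by split; [exact: KJ|rewrite e2 ghK].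
Qed.

Lemma rotate_same_profile (p q : ambient R n) : hyperbolicXR p -> hyperbolicXR q ->
  tim p = tim q -> tau p.1 = tau q.1 -> exists2 B, rotation_matrix B & rotate B p = q.
Proof.
move=> hp hq tt ee; have hh := tau_inj hp hq ee.
have dd : dot (lsubmx p.1) (lsubmx p.1) = dot (lsubmx q.1) (lsubmx q.1).
  have [e1 _] := hp; have [e2 _] := hq; move: e1 e2; rewrite !lorentzE hh; lra.
have [B rB BE] := rotation_transitive n_ge2 dd.
exists B => //; apply: ambient_eq; rewrite /rotate /= ?row_mxKl //.
by rewrite /hgt /height /= row_mxKr; exact: hh.
Qed.

End Global.

Lemma spindle_nonempty_family (R : realType) (n : nat) : (2 <= n)%N ->
  exists S : set (ambient R n), spindle S.
Proof.
move=> n_ge2.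
have s1 : `|0 : R| < 1 by rewrite normr0.
have [t0 [g0 [J [g [g00 sol _ _ _]]]]] := spindle_exists n_ge2 0 (@ltr01 R) s1.
have [J' [g' [maxi _ _]]] := spindle_maximal sol.
by exists [set q | [/\ hyperbolicXR q, J' q.2 & tau q.1 = g' q.2]], t0, g0, J', g'.
Qed.

Theorem theorem4p2 (R : realType) (n : nat) (n_ge2 : (2 <= n)%N)
    (M : set (ambient R n))
    (M_connected : connected M)
    (M_rotinv : rotationally_invariant M)
    (M_timelike : timelike M)
    (M_translator : translator M) :
  exists2 S : set (ambient R n),
    spindle S & open_subset_of M S.
Proof.
(* The empty set counts as connected; it is the empty open subset of any spindle. *)
have [M0|/set0P[q0 Mq0]] := eqVneq M set0.
  have [S HS] := spindle_nonempty_family R n_ge2; exists S => //.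
  by exists set0; [exact: open0|rewrite setI0].
have M_hyp : M `<=` @hyperbolicXR R n by case: M_translator => -[].
have [t0 [g0 [J [g [g00 maxi MJ]]]]] :=
  translator_on_maximal_graph n_ge2 M_connected M_rotinv M_timelike M_translator Mq0.
pose S : set (ambient R n) := [set q | [/\ hyperbolicXR q, J q.2 & tau q.1 = g q.2]].
exists S; first by exists t0, g0, J, g.
have SM q : M q -> exists2 U, open U & U q /\ S `&` U `<=` M.
  move=> Mq.
  have [e e0 He] := tim_open n_ge2 M_rotinv M_timelike M_translator Mq openT I.
  (* A condition on time alone suffices: a spindle point at such a time shares time and distance to
     the axis with some point of [M], hence is a rotation of it. *)
  exists ((@tim R n) @^-1` ball (tim q) e).
    apply: open_comp; last exact: ball_open.
    by move=> x _; exact: cvg_snd.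
  split; first exact: ballxx.
  move=> q' [[hq' Jq' tq'] bq'].
  have [|q2 [Mq2 _ t2]] := He (tim q'); first by rewrite distrC.
  have [_ tau2] := MJ q2 Mq2.
  have [|B rB <-] := rotate_same_profile n_ge2 (M_hyp q2 Mq2) hq' t2; last exact: M_rotinv.
  by rewrite tau2 t2 tq'.
exists (\bigcup_(U in [set U | open U /\ S `&` U `<=` M]) U).
  by apply: bigcup_open => U [].
rewrite eqEsubset; split=> q.
  move=> Mq; split; first by have [? ?] := MJ q Mq; split => //; exact: M_hyp.
  by have [U Uo [Uq SU]] := SM q Mq; exists U.
by move=> [Sq [U [_ SU] Uq]]; apply: SU.
Qed.
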